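(* Let $M$ be a simple matroid of rank $3$ on a ground set $E$ of size $n$ with no coloops. Then $$\frac{2n-6}{n-2}\leq \frac{\overline{c}_1^2(M)}{\overline{c}_2(M)}\leq 3.$$ Equality holds on the left if and only if $M$ is the uniform matroid $U_{3,n}$, and equality holds on the right if and only if $M$ is the matroid of a finite projective plane.
   Context: Matroid notions. For a matroid $M$ with rank function $r$ on a finite set $E$, a flat is a subset $F\subseteq E$ with $r(F\cup\{j\})>r(F)$ for all $j\in E\setminus F$; a loop is an element $i$ with $r(\{i\})=0$; a coloop is an element $i$ with $r(E\setminus\{i\})=r(E)-1$; distinct $i,j$ are parallel if $r(\{i,j\})=1$. $M$ is simple if it has neither loops nor parallel points. For $S\subseteq E$, $M|S$ is the restriction to $S$, and $M/S$ is the contraction, on $E\setminus S$, with rank function $T\mapsto r(T\cup S)-r(S)$. The beta invariant is $\beta(M)=(-1)^{r(E)}\sum_{S\subseteq E}(-1)^{|S|}r(S)$. The uniform matroid $U_{3,n}$ has rank function $r(S)=\min(|S|,3)$ on a set of size $n$. The matroid of a finite projective plane is the simple rank $3$ matroid whose ground set is the set of points of the plane and whose rank $2$ flats are the lines (a projective plane is a point-line incidence structure in which any two distinct points lie on a unique line, any two distinct lines meet in a unique point, and there are four points no three of which are collinear). Bergman fan. Let $M$ be a loopless matroid of rank $d+1$ on $E$ (here $d=2$). Let $N=\mathbb{Z}^E/\mathbb{Z}\mathbf{1}$ with $\mathbf 1=\sum_{i\in E}e_i$, let $u_i$ be the image of $e_i$ in $N$ and $u_S=\sum_{i\in S}u_i$.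 The Bergman fan $\Sigma_M$ is the pure $d$-dimensional fan in $N\otimes\mathbb{R}$ with cones $\sigma_{\mathcal F}=\mathrm{Cone}(u_{F_1},\dots,u_{F_k})$ for each chain of flats $\mathcal F:\emptyset\subsetneq F_1\subsetneq\cdots\subsetneq F_k\subsetneq E$. Minkowski weights. $MW_k(\Sigma_M)$ is the group of integer-valued functions $\omega$ on the $k$-dimensional cones of $\Sigma_M$ satisfying the balancing condition: for every $(k-1)$-dimensional cone $\tau$, $\sum_{F}\omega(\tau+\mathbb{R}_{\ge 0}u_F)\,u_F\in \mathrm{span}(\tau)$, the sum running over flats $F$ such that $\tau+\mathbb{R}_{\ge0}u_F$ is a $k$-dimensional cone of $\Sigma_M$. Product: let $A^*(M)=\mathbb{Z}[x_F: F \text{ a nonempty proper flat}]/(I+J)$, where $I$ is generated by the $x_Fx_G$ with $F,G$ incomparable and $J$ by $\sum_{F\ni i}x_F-\sum_{F\ni j}x_F$ for $i,j\in E$, and let $\deg:A^d(M)\to\mathbb{Z}$ be the isomorphism with $\deg(x_{F_1}\cdots x_{F_d})=1$ for every maximal chain $\emptyset\subsetneq F_1\subsetneq\cdots\subsetneq F_d\subsetneq E$. For each $k$ the map $A^{d-k}(M)\to MW_k(\Sigma_M)$ sending $a$ to $\sigma_{\mathcal F}\mapsto \deg(a\,x_{F_1}\cdots x_{F_k})$ is an isomorphism, and the product $MW_k(\Sigma_M)\times MW_l(\Sigma_M)\to MW_{k+l-d}(\Sigma_M)$ is the one transported from $A^*(M)$. The isomorphism $\mathrm{w}:MW_0(\Sigma_M)\to\mathbb{Z}$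 returns the weight of the vertex. CSM cycles. For $0\le k\le d$, $\mathrm{csm}_k(M)\in MW_k(\Sigma_M)$ is the Minkowski weight given by $\omega(\sigma_{\mathcal F})=(-1)^{d-k}\prod_{i=0}^k\beta(M|F_{i+1}/F_i)$ for a chain $\mathcal F:\emptyset=F_0\subsetneq F_1\subsetneq\cdots\subsetneq F_k\subsetneq F_{k+1}=E$. Chern numbers. For $M$ of rank $3$ (so $d=2$), the Chern numbers are $\overline c_1^2(M)=\mathrm{w}(\mathrm{csm}_1(M)\cdot\mathrm{csm}_1(M))$ and $\overline c_2(M)=\mathrm{w}(\mathrm{csm}_0(M))$. *)

(* Defs.v *)
From HB Require Import structures.
From mathcomp Require Import all_boot all_order all_algebra ring_quotient.
From mathcomp Require Import boolp Rstruct.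
From mathcomp Require Import mpoly.
From Stdlib Require Import ClassicalEpsilon.

Set Implicit Arguments.
Unset Strict Implicit.
Unset Printing Implicit Defensive.

Import GRing.Theory Num.Theory.
Local Open Scope ring_scope.
Local Open Scope quotient_scope.

(* The ground set is a subset of an ambient finite type, so that a matroid and
   all its minors live over the same type.  Only the values of [rk] on subsets
   of [ground] are meaningful. *)
Record matroid (T : finType) := Matroid {
  ground : {set T};
  rk : {set T} -> nat;
  rk_card : forall S : {set T}, S \subset ground -> (rk S <= #|S|)%N;
  rk_mono : forall S S' : {set T}, S \subset S' -> S' \subset ground ->
    (rk S <= rk S')%N;
  rk_submod : forall S S' : {set T}, S \subset ground -> S' \subset ground ->
    (rk (S :|: S') + rk (S :&: S') <= rk S + rk S')%N
}.

Section MatroidNotions.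
Variables (T : finType) (M : matroid T).
Implicit Types (S F : {set T}) (i j : T).

Definition rank : nat := rk M (ground M).

Definition flat F : bool :=
  (F \subset ground M) &&
  [forall j in ground M :\: F, (rk M F < rk M (j |: F))%N].

Definition loop i : bool := (i \in ground M) && (rk M [set i] == 0)%N.

Definition coloop i : bool :=
  (i \in ground M) && ((rk M (ground M :\ i)).+1 == rank).

Definition parallel i j : bool :=
  [&& i \in ground M, j \in ground M, i != j & rk M [set i; j] == 1%N].

Definition simple_matroid : bool :=
  [forall i, ~~ loop i] && [forall i, forall j, ~~ parallel i j].

Definition beta : int :=
  (-1) ^+ rank *
  \sum_(S : {set T} | S \subset ground M) (-1) ^+ #|S| * (rk M S)%:Z.

Fact restrict_card S S' :
  S' \subset S :&: ground M -> (rk M S' <= #|S'|)%N.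
Proof. by rewrite subsetI => /andP[_]; apply: rk_card. Qed.

Fact restrict_mono S S1 S2 :
  S1 \subset S2 -> S2 \subset S :&: ground M -> (rk M S1 <= rk M S2)%N.
Proof. by move=> s12; rewrite subsetI => /andP[_]; apply: rk_mono. Qed.

Fact restrict_submod S S1 S2 :
  S1 \subset S :&: ground M -> S2 \subset S :&: ground M ->
  (rk M (S1 :|: S2) + rk M (S1 :&: S2) <= rk M S1 + rk M S2)%N.
Proof.
by rewrite !subsetI => /andP[_ s1] /andP[_ s2]; apply: rk_submod.
Qed.

Definition restrict S : matroid T :=
  Matroid (@restrict_card S) (@restrict_mono S) (@restrict_submod S).

Definition contract_rk S S' : nat :=
  rk M (S' :|: (S :&: ground M)) - rk M (S :&: ground M).

Let subGU S S' : S' \subset ground M :\: S ->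
  S' :|: (S :&: ground M) \subset ground M.
Proof.
by rewrite subsetD => /andP[sS' _]; rewrite subUset sS' subsetIr.
Qed.

Fact contract_card S S' :
  S' \subset ground M :\: S -> (contract_rk S S' <= #|S'|)%N.
Proof.
move=> sS'; rewrite /contract_rk leq_subLR addnC.
have sG : S' \subset ground M by apply: subset_trans sS' (subsetDl _ _).
apply: leq_trans (leq_add (rk_card sG) (leqnn _)).
apply: leq_trans (rk_submod sG (subsetIr S _)).
exact: leq_addr.
Qed.

Fact contract_mono S S1 S2 :
  S1 \subset S2 -> S2 \subset ground M :\: S ->
  (contract_rk S S1 <= contract_rk S S2)%N.
Proof.
move=> s12 s2; apply: leq_sub2r; apply: rk_mono; first exact: setSU.
exact: subGU.
Qed.

Fact contract_submod S S1 S2 :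
  S1 \subset ground M :\: S -> S2 \subset ground M :\: S ->
  (contract_rk S (S1 :|: S2) + contract_rk S (S1 :&: S2)
     <= contract_rk S S1 + contract_rk S S2)%N.
Proof.
move=> s1 s2; rewrite /contract_rk; set C := S :&: ground M.
have ge (A : {set T}) : A \subset ground M :\: S -> (rk M C <= rk M (A :|: C))%N.
  by move=> sA; apply: rk_mono; [apply: subsetUr | apply: subGU].
have s12 : S1 :&: S2 \subset ground M :\: S.
  by apply: subset_trans s1; apply: subsetIl.
have u12 : S1 :|: S2 \subset ground M :\: S by rewrite subUset s1.
have := rk_submod (subGU s1) (subGU s2); rewrite -/C.
rewrite -setUUl -setUIl => le.
rewrite -(leq_add2r (rk M C + rk M C)) addnACA [leqRHS]addnACA.
by rewrite !subnK ?ge.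
Qed.

Definition contract S : matroid T :=
  Matroid (@contract_card S) (@contract_mono S) (@contract_submod S).

Definition is_uniform (r : nat) : Prop :=
  forall S, S \subset ground M -> rk M S = minn #|S| r.

End MatroidNotions.

Arguments ground {T}.
Arguments rk {T}.

(* A line is identified with its set of points. *)
Definition projective_plane (T : finType) (points : {set T})
    (lines : {set {set T}}) : Prop :=
  [/\ forall L : {set T}, L \in lines -> L \subset points,
      forall p q, p \in points -> q \in points -> p != q ->
        exists! L : {set T}, [/\ L \in lines, p \in L & q \in L],
      forall L L' : {set T}, L \in lines -> L' \in lines -> L != L' ->
        exists! p, p \in L :&: L'
    & exists Q : {set T}, [/\ Q \subset points, #|Q| = 4%N &
        forall A : {set T}, A \subset Q -> #|A| = 3%N ->
          ~ exists2 L : {set T}, L \in lines & A \subset L]].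

Definition is_projective_plane_matroid (T : finType) (M : matroid T) : Prop :=
  exists2 lines : {set {set T}}, projective_plane (ground M) lines &
    [/\ simple_matroid M, rank M = 3%N &
        forall F, (flat M F && (rk M F == 2)%N) = (F \in lines)].

Section BergmanFan.
Variables (T : finType) (M : matroid T).

(* A loopless matroid of rank d + 1 has a d-dimensional Bergman fan. *)
Definition dim : nat := (rank M).-1.

Definition proper_flat (F : {set T}) : bool :=
  [&& flat M F, F != set0 & F != ground M].

Definition pflat := {F : {set T} | proper_flat F}.

HB.instance Definition _ := Finite.on pflat.

(* The cones of the Bergman fan are simplicial, and are in bijection with the
   chains of nonempty proper flats: a k-dimensional cone is encoded by its
   chain F_1 < ... < F_k. *)
Definition flat_lt (F G : pflat) : bool := val F \proper val G.

Definition is_chain (s : seq pflat) : bool := sorted flat_lt s.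

Definition cone (k : nat) := {s : k.-tuple pflat | is_chain s}.

HB.instance Definition _ k := Finite.on (cone k).

Definition flats_of k (sigma : cone k) : seq pflat := val (val sigma).

Definition vertex : cone 0 := exist _ [tuple] isT.

(* Vectors of N (x) R = R^E / R.1 are represented by their lifts to R^E (inside
   R^T), so the span of the u_G in N (x) R is the span of 1 and of the lifts
   of the u_G. *)
Definition uvec (S : {set T}) : {ffun T -> Rdefinitions.R^o} :=
  [ffun i => (i \in S)%:R].

Definition cone_span k (tau : cone k) : {vspace {ffun T -> Rdefinitions.R^o}} :=
  <<uvec (ground M) :: [seq uvec (val F) | F <- flats_of tau]>>%VS.

(* For each F, the inner sum has at most one term, namely the cone spanned by
   tau and u_F if it is a k-dimensional cone of the fan. *)
Definition balanced k (w : {ffun cone k -> int}) : bool :=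
  (0 < k)%N ==> [forall tau : cone k.-1,
    \sum_(F : pflat)
      \sum_(sigma : cone k | perm_eq (flats_of sigma) (F :: flats_of tau))
        (w sigma)%:~R *: uvec (val F)
    \in cone_span tau].

Fact balanced_zmod_closed k : zmod_closed (@balanced k).
Proof.
split=> [|u v]; rewrite !unfold_in /balanced.
  case: k => //= k; apply/forallP=> tau; rewrite big1 ?mem0v // => F _.
  by rewrite big1 // => s _; rewrite ffunE scale0r.
case: k u v => //= k u v /forallP bu /forallP bv; apply/forallP=> tau.
apply: etrans (memvB (bu tau) (bv tau)); congr (in_mem _ _).
rewrite -sumrB; apply: eq_bigr => F _; rewrite -sumrB; apply: eq_bigr => s _.
by rewrite -scalerBl !ffunE rmorphB.
Qed.

HB.instance Definition _ k :=
  GRing.isZmodClosed.Build _ (@balanced k) (@balanced_zmod_closed k).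

Definition MW (k : nat) := {w : {ffun cone k -> int} | balanced w}.

HB.instance Definition _ k := SubChoice.on (MW k).
HB.instance Definition _ k := [SubChoice_isSubZmodule of MW k by <:].

End BergmanFan.

Section ChowRing.
Variables (T : finType) (M : matroid T).

Local Notation P := {mpoly int[#|{: pflat M}|]}.

Definition pvar (F : pflat M) : P := 'X_(enum_rank F).

Fact pvar_eval0 (F : pflat M) : (pvar F).@[fun=> 0] = 0.
Proof. exact: mevalXU. Qed.

Fact sum_pvar_eval0 (i : T) :
  (\sum_(F : pflat M | i \in val F) pvar F).@[fun=> 0] = 0.
Proof. by rewrite raddf_sum big1 // => F _; apply: pvar_eval0. Qed.

Definition incomparable (F G : pflat M) : bool :=
  ~~ (val F \subset val G) && ~~ (val G \subset val F).

Definition chow_rel1 : seq P :=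
  [seq pvar FG.1 * pvar FG.2 |
    FG <- enum [set FG : pflat M * pflat M | incomparable FG.1 FG.2]].

Definition chow_rel2 : seq P :=
  [seq \sum_(F : pflat M | ij.1 \in val F) pvar F
       - \sum_(F : pflat M | ij.2 \in val F) pvar F |
    ij : T * T <- enum (setX (ground M) (ground M))].

Definition chow_rels : seq P := chow_rel1 ++ chow_rel2.

Definition chow_ideal : {pred P} := fun p =>
  `[< exists c : 'I_(size chow_rels) -> P, p = \sum_i c i * chow_rels`_i >].

Fact chow_idealr_closed : idealr_closed chow_ideal.
Proof.
split.
- by apply/asboolP; exists (fun=> 0); rewrite big1 // => i _; rewrite mul0r.
- apply/asboolP=> -[c /(congr1 (fun p : P => p.@[fun=> 0]))].
  rewrite meval1 raddf_sum big1 => [|i _]; first by move/eqP; rewrite oner_eq0.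
  rewrite [LHS]mevalM; suff -> : (chow_rels`_i).@[fun=> 0] = 0 by rewrite mulr0.
  have : chow_rels`_i \in chow_rels by rewrite mem_nth.
  rewrite mem_cat => /orP[] /mapP[x _ ->].
    by rewrite mevalM pvar_eval0 mul0r.
  by rewrite mevalB !sum_pvar_eval0 subr0.
- move=> a p q /asboolP[c ->] /asboolP[c' ->]; apply/asboolP.
  exists (fun i => a * c i + c' i); rewrite mulr_sumr -big_split /=.
  by apply: eq_bigr => i _; rewrite mulrDl mulrA.
Qed.

HB.instance Definition _ := isIdealr.Build _ chow_ideal chow_idealr_closed.

Definition chow := {ideal_quot chow_ideal}.

HB.instance Definition _ := GRing.ComNzRing.on chow.

Definition chow_proj (p : P) : chow := \pi_{ideal_quot chow_ideal} p.

Fact chow_proj_zmod_morphism : zmod_morphism chow_proj.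
Proof. exact: (rmorphB (\pi_{ideal_quot chow_ideal} : {rmorphism _ -> _})). Qed.

Fact chow_proj_monoid_morphism : monoid_morphism chow_proj.
Proof. by split=> [|p q]; rewrite /chow_proj ?rmorph1 ?rmorphM. Qed.

HB.instance Definition _ :=
  GRing.isZmodMorphism.Build P chow chow_proj chow_proj_zmod_morphism.
HB.instance Definition _ :=
  GRing.isMonoidMorphism.Build P chow chow_proj chow_proj_monoid_morphism.

Fact chow_proj_rel (p : P) : p \in chow_rels -> chow_proj p = 0.
Proof.
move=> hp; have lt : (index p chow_rels < size chow_rels)%N by rewrite index_mem.
apply/eqP; rewrite -(rmorph0 chow_proj) -Quotient.idealrBE subr0.
apply/asboolP; exists (fun i => ((i : nat) == index p chow_rels)%:R).
rewrite (bigD1 (Ordinal lt)) //= eqxx mul1r nth_index // big1 ?addr0 // => i.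
by rewrite -val_eqE /= => /negbTE ->; rewrite mul0r.
Qed.

Definition xvar (F : pflat M) : chow := chow_proj (pvar F).

Fact xvar_incomparable F G : incomparable F G -> xvar F * xvar G = 0.
Proof.
move=> FG; rewrite -rmorphM /=; apply: chow_proj_rel; rewrite mem_cat.
apply/orP; left; apply/mapP; exists (F, G) => //.
by rewrite mem_enum inE.
Qed.

Fact xvar_linear i j : i \in ground M -> j \in ground M ->
  \sum_(F : pflat M | i \in val F) xvar F
    = \sum_(F : pflat M | j \in val F) xvar F.
Proof.
move=> iE jE; apply/eqP; rewrite -subr_eq0 -!raddf_sum -raddfB /=; apply/eqP.
apply: chow_proj_rel; rewrite mem_cat; apply/orP; right.
by apply/mapP; exists (i, j) => //; rewrite mem_enum inE iE.
Qed.

Definition chow_gr (k : nat) (a : chow) : Prop :=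
  exists2 p : P, p \is k.-homog & a = chow_proj p.

Definition xmon k (sigma : cone M k) : chow :=
  \prod_(F <- flats_of sigma) xvar F.

(* The isomorphism deg : A^d -> Z, extended by zero to the other degrees. *)
Definition is_degree_map (f : {additive chow -> int}) : Prop :=
  [/\ forall sigma : cone M (dim M), f (xmon sigma) = 1,
      forall a b, chow_gr (dim M) a -> chow_gr (dim M) b -> f a = f b -> a = b,
      forall z, exists2 a, chow_gr (dim M) a & f a = z
    & forall k a, k != dim M -> chow_gr k a -> f a = 0].

Definition deg : {additive chow -> int} :=
  epsilon (inhabits (\0%R : {additive chow -> int})) is_degree_map.

Definition deg_weight k (a : chow) : {ffun cone M k -> int} :=
  [ffun sigma => deg (a * xmon sigma)].

Fact flat_lt_trans : transitive (@flat_lt T M).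
Proof. by move=> ? ? ?; apply: proper_trans. Qed.

Fact comparable_of_chain (s : seq (pflat M)) F G :
  is_chain s -> F \in s -> G \in s -> ~~ incomparable F G.
Proof.
rewrite /is_chain sorted_pairwise ?/flat_lt; last exact: flat_lt_trans.
move=> /(pairwiseP F) ps Fs Gs.
rewrite /incomparable negb_and !negbK.
have [iF iG] : (index F s < size s)%N /\ (index G s < size s)%N.
  by rewrite !index_mem.
have := ps _ _ iF iG; have := ps _ _ iG iF; rewrite !nth_index // => GF FG.
have [/FG/proper_sub -> //|/GF/proper_sub -> |] := ltngtP (index F s) (index G s).
  by rewrite orbT.
move=> e; suff -> : F = G by rewrite subxx.
by rewrite -(nth_index F Fs) e nth_index.
Qed.

Fact cone_unique k (sigma sigma' : cone M k) :
  perm_eq (flats_of sigma) (flats_of sigma') -> sigma = sigma'.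
Proof.
move=> e; apply/val_inj/val_inj.
apply: (sorted_eq flat_lt_trans _ (valP sigma) (valP sigma') e) => F G.
move=> /andP[/proper_sub FG /proper_sub GF].
by apply/val_inj/eqP; rewrite eqEsubset FG.
Qed.

Fact cone_insert k (tau : cone M k) F :
  F \notin flats_of tau ->
  (forall G, G \in flats_of tau -> ~~ incomparable F G) ->
  exists sigma : cone M k.+1, perm_eq (flats_of sigma) (F :: flats_of tau).
Proof.
move=> Ft cmp; pose le (F G : pflat M) := val F \subset val G.
pose t := F :: flats_of tau; pose s := sort le t.
have ut : uniq t.
  rewrite /= Ft /=; apply: (sorted_uniq flat_lt_trans _ (valP tau)).
  by move=> G; rewrite /flat_lt properxx.
have tot : {in t &, total le}.
  have h G H : G \in t -> H \in t -> ~~ incomparable G H.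
    rewrite !inE => /orP[/eqP->|Gt] /orP[/eqP->|Ht].
    - by rewrite /incomparable subxx.
    - exact: cmp.
    - by rewrite /incomparable andbC; apply: cmp.
    - exact: comparable_of_chain (valP tau) Gt Ht.
  by move=> G H Gt Ht; have := h _ _ Gt Ht; rewrite negb_and !negbK.
have ss : is_chain s.
  have sle : sorted le s by apply: (sort_sorted_in tot); apply/allP.
  have us : uniq s by rewrite sort_uniq.
  have le_tr : transitive le by move=> ? ? ?; apply: subset_trans.
  rewrite /is_chain sorted_pairwise; last exact: flat_lt_trans.
  rewrite sorted_pairwise // in sle; rewrite uniq_pairwise in us.
  have : pairwise [rel G H | le G H && (G != H)] s.
    by rewrite pairwise_relI sle us.
  apply: sub_pairwise => G H /= /andP[GH neq].
  rewrite /flat_lt properEneq [val G \subset _]GH andbT.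
  by apply: contraNneq neq => /val_inj->.
have sz : size s == k.+1 by rewrite size_sort /= size_tuple.
by exists (exist _ (Tuple sz) ss); rewrite /flats_of /= perm_sort.
Qed.

Fact deg_weight_balanced k (a : chow) : balanced (deg_weight k a).
Proof.
rewrite /balanced; case: k => //= k; apply/forallP => tau.
set b := a * xmon tau.
have inner (F : pflat M) : F \notin flats_of tau ->
    \sum_(sigma : cone M k.+1 | perm_eq (flats_of sigma) (F :: flats_of tau))
      (deg_weight k.+1 a sigma)%:~R *: uvec (val F)
    = (deg (b * xvar F))%:~R *: uvec (val F).
  move=> Ft; have [cmp|] := boolP [forall G in flats_of tau, ~~ incomparable F G].
    have [sigma sP] := cone_insert Ft (fun G => elimT forall_inP cmp G).
    rewrite (big_pred1 sigma) => [|sigma' /=].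
      rewrite ffunE /xmon (perm_big _ sP) big_cons /= /b /xmon.
      by rewrite mulrCA mulrC.
    apply/idP/eqP => [h|-> //]; apply: cone_unique.
    by rewrite (permPl h) perm_sym.
  rewrite negb_forall => /existsP[G]; rewrite negb_imply negbK => /andP[Gt FG].
  rewrite big_pred0 => [|sigma].
    rewrite /b /xmon (perm_big _ (perm_to_rem Gt)) big_cons -mulrA.
    rewrite (mulrC _ (xvar F)) (mulrA (xvar F)) (xvar_incomparable FG).
    by rewrite mul0r mulr0 raddf0 scale0r.
  apply/negP => h; move: FG; apply/negP.
  apply: (comparable_of_chain (valP sigma)).
    by rewrite (perm_mem h) mem_head.
  by rewrite (perm_mem h) inE Gt orbT.
have other (F : pflat M) : F \in flats_of tau -> uvec (val F) \in cone_span tau.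
  by move=> Ft; apply: memv_span; rewrite in_cons (map_f (fun G => uvec (val G)) Ft) orbT.
have -> : \sum_(F : pflat M)
   \sum_(sigma : cone M k.+1 | perm_eq (flats_of sigma) (F :: flats_of tau))
      (deg_weight k.+1 a sigma)%:~R *: uvec (val F) =
   \sum_(F : pflat M) (deg (b * xvar F))%:~R *: uvec (val F) -
   \sum_(F in flats_of tau) ((deg (b * xvar F))%:~R *: uvec (val F) -
     \sum_(sigma : cone M k.+1 | perm_eq (flats_of sigma) (F :: flats_of tau))
      (deg_weight k.+1 a sigma)%:~R *: uvec (val F)).
  rewrite [X in _ = _ - X]big_mkcond -sumrB; apply: eq_bigr => F _.
  case: ifP => [_|/negbT Ft]; first by rewrite opprB addrC subrK.
  by rewrite subr0 inner.
apply: memvB; last first.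
  apply: memv_suml => F Ft; apply: memvB; first by rewrite memvZ ?other.
  by apply: memv_suml => sigma _; rewrite memvZ ?other.
have [E0|[i0 i0E]] := set_0Vmem (ground M).
  rewrite big1 ?mem0v // => F _.
  have /and3P[/andP[sF _] F0 _] := valP F.
  by move: F0; rewrite -subset0 -E0 sF.
pose c := deg (b * \sum_(F : pflat M | i0 \in val F) xvar F).
suff -> : \sum_(F : pflat M) (deg (b * xvar F))%:~R *: uvec (val F)
    = c%:~R *: uvec (ground M) by rewrite memvZ // memv_span ?mem_head.
apply/ffunP => i; rewrite sum_ffunE !ffunE.
have [iE|iE] := boolP (i \in ground M).
  rewrite /c (xvar_linear i0E iE) mulr_sumr raddf_sum rmorph_sum /=.
  rewrite [RHS]mulr1 [RHS]big_mkcond /=; apply: eq_bigr => F _.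
  by rewrite !ffunE; case: ifP => _; [exact: mulr1 | exact: mulr0].
rewrite [RHS]mulr0 big1 // => F _; rewrite !ffunE.
have /and3P[/andP[/subsetP sF _] _ _] := valP F.
by rewrite (negbTE (contra (sF i) iE)) [LHS]mulr0.
Qed.

(* The isomorphism A^(d-k) -> MW_k; the formula makes sense on all of A. *)
Definition chow_to_MW k (a : chow) : MW M k :=
  exist _ (deg_weight k a) (deg_weight_balanced k a).

Definition MW_to_chow k (w : MW M k) : chow :=
  epsilon (inhabits 0) (fun a => chow_gr (dim M - k) a /\ chow_to_MW k a = w).

(* The product of MW_k and MW_l lands in MW_m with m = k + l - d; it is
   transported from the product A^(d-k) x A^(d-l) -> A^(d-m). *)
Definition MW_mul k l m (klm : (k + l = m + dim M)%N)
    (u : MW M k) (v : MW M l) : MW M m :=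
  chow_to_MW m (MW_to_chow u * MW_to_chow v).

Definition vertex_weight (w : MW M 0) : int := val w (vertex M).

End ChowRing.

Section ChernNumbers.
Variables (T : finType) (M : matroid T).

Definition csm_weight k : {ffun cone M k -> int} := [ffun sigma =>
  let F := nth set0 (set0 :: rcons (map val (flats_of sigma)) (ground M)) in
  (-1) ^+ (dim M - k) *
  \prod_(i < k.+1) beta (contract (restrict M (F i.+1)) (F i))].

(* [csm_weight k] is balanced when M is loopless, so that [csm k] is the
   Minkowski weight with these values. *)
Definition csm k : MW M k := insubd 0 (csm_weight k).

Fact rank3_dim : rank M = 3%N -> (1 + 1 = 0 + dim M)%N.
Proof. by rewrite /dim => ->. Qed.

Definition c1_sq (rk3 : rank M = 3%N) : int :=
  vertex_weight (MW_mul (rank3_dim rk3) (csm 1) (csm 1)).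

Definition c2 : int := vertex_weight (csm 0).

End ChernNumbers.

(* Main.v *)
(* Write [k] for the number of points of a rank 2 flat [L], [n] for the
   number of points and [b] for the number of rank 2 flats.  In [A^*(M)] the classes
   [alpha = \sum_(F \ni i) x_F] and [x_L] span [A^1(M)] and the degree pairing on
   them is [diag(1, -1, ..., -1)]; [csm_1] corresponds to
   [(3 - n) alpha + \sum_L (k - 2) x_L].  Expanding the rank functions of [M] and
   of its minors in indicators of flats gives the beta invariants, so that
     c_1^2 = (n - 3)^2 - \sum_L (k - 2)^2   and   c_2 = 3 - 2 n + \sum_L (k - 1).
   Since [\sum_L k (k - 1) = n (n - 1)], it follows that
     3 c_2 - c_1^2 = b - n   and
     (n - 2) c_1^2 - (2 n - 6) c_2 = \sum_L (k - 2) (n - k - 1).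
   The first number is nonnegative by the de Bruijn-Erdos theorem, and zero only
   if any two lines meet.  The second is nonnegative because [2 <= k <= n - 2] in
   the absence of coloops, and zero only if all lines have two points. *)
Require Import Defs.
From HB Require Import structures.
From Stdlib Require Import ClassicalEpsilon.
From mathcomp Require Import all_boot all_order all_algebra ring_quotient.
From mathcomp Require Import mpoly boolp zify ring lra.
Set Implicit Arguments.
Unset Strict Implicit.
Unset Printing Implicit Defensive.
Import Order.TTheory GRing.Theory Num.Theory.
Local Open Scope ring_scope.

(** * Linear spaces *)

(** A nondegenerate finite linear space: [line_neq] excludes a single line carrying all points. The
    points and rank 2 flats of [M] will form one. *)
Record linear_space (T : finType) (E : {set T}) (Ls : {set {set T}}) : Prop :=
  LinearSpace {
  line_sub : forall L : {set T}, L \in Ls -> L \subset E;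
  line_gt1 : forall L : {set T}, L \in Ls -> (1 < #|L|)%N;
  line_neq : forall L : {set T}, L \in Ls -> L != E;
  line_join : forall p q, p \in E -> q \in E -> p != q ->
    exists L : {set T}, [/\ L \in Ls, p \in L & q \in L];
  line_inj : forall (L L' : {set T}) p q, L \in Ls -> L' \in Ls -> p != q ->
    p \in L -> q \in L -> p \in L' -> q \in L' -> L = L'
}.

Definition pencil (T : finType) (Ls : {set {set T}}) (p : T) :=
  [set L in Ls | p \in L].

Lemma card_sum_mem (T : finType) (A B : {set T}) :
  #|A :&: B| = (\sum_(x in A) (x \in B))%N.
Proof.
rewrite -sum1_card big_mkcond [RHS]big_mkcond; apply: eq_bigr => x _.
by rewrite inE; case: (x \in A).
Qed.

Section LinearSpaceTheory.
Variables (T : finType) (E : {set T}) (Ls : {set {set T}}).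
Hypothesis lsE : linear_space E Ls.

Lemma card_pencil p : #|pencil Ls p| = (\sum_(L in Ls) (p \in L))%N.
Proof.
rewrite -sum1_card big_mkcond [RHS]big_mkcond; apply: eq_bigr => L _.
by rewrite inE; case: (L \in Ls).
Qed.

Lemma card_line L : L \in Ls -> #|L| = (\sum_(p in E) (p \in L))%N.
Proof. by move=> /(line_sub lsE) LE; rewrite -card_sum_mem (setIidPr LE). Qed.

Lemma sum_card_line : (\sum_(L in Ls) #|L| = \sum_(p in E) #|pencil Ls p|)%N.
Proof.
rewrite (eq_bigr _ card_line) exchange_big; apply: eq_bigr => p _.
by rewrite card_pencil.
Qed.

Lemma lines_through p q : p \in E -> q \in E -> p != q ->
  (\sum_(L in pencil Ls p) (q \in L) = 1)%N.
Proof.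
move=> pE qE pq; have [L [LL pL qL]] := line_join lsE pE qE pq.
rewrite (bigD1 L) ?inE ?LL //= qL big1 // => L'; rewrite inE => /andP[/andP[L'L pL'] nLL'].
apply/eqP; rewrite eqb0; apply: contra nLL' => qL'; apply/eqP.
exact (line_inj lsE L'L LL pq pL' qL' pL qL).
Qed.

(** The lines through [p] partition the remaining points. *)
Lemma sum_pencil_line p : p \in E ->
  (\sum_(L in pencil Ls p) #|L|.-1 = #|E|.-1)%N.
Proof.
move=> pE; rewrite (cardsD1 p E) pE /= -sum1_card.
transitivity (\sum_(q in E :\ p) \sum_(L in pencil Ls p) (q \in L))%N; last first.
  apply: eq_bigr => q; rewrite !inE => /andP[qp qE]; rewrite lines_through //.
  by rewrite eq_sym.
rewrite exchange_big; apply: eq_bigr => L; rewrite inE => /andP[LL pL].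
rewrite -card_sum_mem (cardsD1 p L) pL /=; apply/eq_card => q.
rewrite !inE; case: (boolP (q \in L)) => [/(subsetP (line_sub lsE LL)) ->|_].
  by rewrite !andbT.
by rewrite !andbF.
Qed.

(** Ordered pairs of distinct points, counted by the line that joins them. *)
Lemma sum_line_pairs :
  (\sum_(L in Ls) #|L| * #|L|.-1 = #|E| * #|E|.-1)%N.
Proof.
transitivity (\sum_(L in Ls) \sum_(p in E) (p \in L) * #|L|.-1)%N.
  by apply: eq_bigr => L LL; rewrite -big_distrl /= -card_line.
rewrite exchange_big -sum_nat_const; apply: eq_bigr => p pE.
rewrite -(sum_pencil_line pE) big_mkcond [RHS]big_mkcond; apply: eq_bigr => L _.
by rewrite inE; case: (L \in Ls) => //=; case: (p \in L); rewrite ?mul1n ?mul0n.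
Qed.

Lemma card_line_meet L L' : L \in Ls -> L' \in Ls -> L != L' -> (#|L :&: L'| <= 1)%N.
Proof.
move=> LL L'L nLL'; apply: contraR nLL'; rewrite -ltnNge => /card_gt1P[p [q]].
rewrite !inE => -[/andP[pL pL'] /andP[qL qL'] pq]; apply/eqP.
exact (line_inj lsE LL L'L pq pL qL pL' qL').
Qed.

(** Each point of [L] differs from [p], hence lies on exactly one line through [p]. *)
Lemma sum_pencil_meet p L : p \in E -> L \in Ls -> p \notin L ->
  (\sum_(L' in pencil Ls p) #|L :&: L'| = #|L|)%N.
Proof.
move=> pE LL pL; under eq_bigr do rewrite card_sum_mem.
rewrite exchange_big -sum1_card; apply: eq_bigr => q qL.
rewrite lines_through ?pE ?(subsetP (line_sub lsE LL)) //.
by apply: contraNneq pL => ->.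
Qed.

(** In the sum of [sum_pencil_meet] every term is at most 1. *)
Lemma line_le_pencil p L : p \in E -> L \in Ls -> p \notin L ->
  (#|L| <= #|pencil Ls p|)%N.
Proof.
move=> pE LL pL; rewrite -(sum_pencil_meet pE LL pL) -sum1_card.
apply: leq_sum => L'; rewrite inE => /andP[L'L pL']; apply: card_line_meet => //.
by apply: contraNneq pL => ->.
Qed.

(** For [p] on [L'] but not on [L], equality holds in [line_le_pencil], so every line through [p],
    and [L'] in particular, meets [L]. *)
Lemma line_meet L L' : L \in Ls -> L' \in Ls -> L != L' ->
  (forall p, p \in E -> p \notin L -> #|pencil Ls p| = #|L|) -> #|L :&: L'| = 1%N.
Proof.
move=> LL L'L nLL' eqd.
have [p pL' pL] : exists2 p, p \in L' & p \notin L.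
  apply/subsetPn; apply: contra nLL' => sL'L; apply/eqP.
  have /card_gt1P[p [q [pL' qL' pq]]] := line_gt1 lsE L'L.
  by apply: (line_inj lsE LL L'L pq) => //; apply: (subsetP sL'L).
have pE := subsetP (line_sub lsE L'L) _ pL'.
have le1 L1 : L1 \in pencil Ls p -> (#|L :&: L1| <= 1)%N.
  rewrite inE => /andP[L1L pL1]; apply: card_line_meet => //.
  by apply: contraNneq pL => ->.
have := sum_pencil_meet pE LL pL; rewrite -(eqd _ pE pL) -sum1_card.
have L'p : L' \in pencil Ls p by rewrite inE L'L.
rewrite (bigD1 L') //= [RHS](bigD1 L') //=.
have : (\sum_(i in pencil Ls p | i != L') #|L :&: i|
         <= \sum_(i in pencil Ls p | i != L') 1)%N.
  by apply: leq_sum => L1 /andP[/le1].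
move: (le1 _ L'p); move: (\sum_(i in _ | _) #|_|)%N (\sum_(i in _ | _) 1)%N #|_|; lia.
Qed.

(** * The de Bruijn-Erdos theorem and its equality case *)

Lemma exists_off_line L : L \in Ls -> exists2 p, p \in E & p \notin L.
Proof.
move=> LL; apply/subsetPn; apply: contra (line_neq lsE LL) => sEL.
by rewrite eqEsubset sEL (line_sub lsE).
Qed.

Lemma pencil_lt p : p \in E -> (1 < #|E|)%N -> (#|pencil Ls p| < #|Ls|)%N.
Proof.
move=> pE E1; apply: proper_card; rewrite properE.
apply/andP; split; first by apply/subsetP => L; rewrite inE => /andP[].
have /card_gt1P[q0 [q1 [q0E q1E q01]]] := E1.
have [q qE pq] : exists2 q, q \in E & p != q.
  by have [->|] := eqVneq p q0; [exists q1 | exists q0].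
have [L [LL pL qL]] := line_join lsE pE qE pq.
(* The line through [q] and [r] misses [p]: otherwise it would be [L], which does not contain
   [r]. *)
have [r rE rL] := exists_off_line LL.
have [|L' [L'L qL' rL']] := line_join lsE qE rE; first by apply: contraNneq rL => <-.
apply/subsetPn; exists L' => //; rewrite inE L'L /=; apply: contra rL => pL'.
by rewrite (line_inj lsE LL L'L pq).
Qed.

(* Conway's proof of the de Bruijn-Erdos theorem: the weights [1 / (n (b - d_p))]
   and [1 / (b (n - k_L))] of the nonincident pairs [(p, L)] both sum to 1, and
   compare termwise because [k_L <= d_p]. *)
Let nonincident :=
  [pred pL : T * {set T} | [&& pL.1 \in E, pL.2 \in Ls & pL.1 \notin pL.2]].

Lemma conway_points : (1 < #|E|)%N ->
  \sum_(pL | nonincident pL) (#|E|%:R * (#|Ls|%:R - #|pencil Ls pL.1|%:R))^-1 = 1 :> rat.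
Proof.
move=> E1.
have -> : \sum_(pL | nonincident pL) (#|E|%:R * (#|Ls|%:R - #|pencil Ls pL.1|%:R))^-1
  = \sum_(p in E) \sum_(L in Ls | p \notin L)
      (#|E|%:R * (#|Ls|%:R - #|pencil Ls p|%:R))^-1 :> rat.
  by rewrite pair_big_dep.
have E0 : #|E|%:R != 0 :> rat by rewrite pnatr_eq0; lia.
transitivity (\sum_(p in E) #|E|%:R^-1 : rat); last first.
  by rewrite sumr_const -[LHS]mulr_natl divff.
apply: eq_bigr => p pE; have lt := pencil_lt pE E1.
rewrite big_const iter_addr_0 -[LHS]mulr_natr.
suff -> : #|[pred L in Ls | p \notin L]| = (#|Ls| - #|pencil Ls p|)%N.
  rewrite natrB ?(ltnW lt) //.
  have : #|Ls|%:R - #|pencil Ls p|%:R != 0 :> rat by rewrite subr_eq0 eqr_nat; lia.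
  by move=> ?; field; apply/andP.
have -> : #|pencil Ls p| = #|Ls :&: [set L : {set T} | p \in L]|.
  by apply: eq_card => L; rewrite !inE.
by rewrite -cardsD; apply: eq_card => L; rewrite !inE andbC.
Qed.

Lemma conway_lines : (0 < #|Ls|)%N ->
  \sum_(pL | nonincident pL) (#|Ls|%:R * (#|E|%:R - #|pL.2|%:R))^-1 = 1 :> rat.
Proof.
move=> L0.
have -> : \sum_(pL | nonincident pL) (#|Ls|%:R * (#|E|%:R - #|pL.2|%:R))^-1
  = \sum_(L in Ls) \sum_(p in E | p \notin L) (#|Ls|%:R * (#|E|%:R - #|L|%:R))^-1 :> rat.
  rewrite (exchange_big_dep (mem E)) /=; last by move=> L p _ /andP[].
  rewrite pair_big_dep /=; apply: eq_bigl => -[p L] /=.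
  by case: (p \in E); case: (L \in Ls).
have b0 : #|Ls|%:R != 0 :> rat by rewrite pnatr_eq0; lia.
transitivity (\sum_(L in Ls) #|Ls|%:R^-1 : rat); last first.
  by rewrite sumr_const -[LHS]mulr_natl divff.
apply: eq_bigr => L LL.
have lt : (#|L| < #|E|)%N.
  by rewrite proper_card // properEneq (line_neq lsE) ?(line_sub lsE).
rewrite big_const iter_addr_0 -[LHS]mulr_natr.
suff -> : #|[pred p in E | p \notin L]| = (#|E| - #|L|)%N.
  rewrite natrB ?(ltnW lt) //.
  have : #|E|%:R - #|L|%:R != 0 :> rat by rewrite subr_eq0 eqr_nat; lia.
  by move=> ?; field; apply/andP.
rewrite -{2}(setIidPr (line_sub lsE LL)) -cardsD; apply: eq_card => p; rewrite !inE.
by rewrite andbC.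
Qed.

Lemma conway_terms p L : p \in E -> L \in Ls -> p \notin L ->
  (0 < #|Ls|%:R - #|pencil Ls p|%:R :> rat) && (0 < #|E|%:R - #|L|%:R :> rat).
Proof.
move=> pE LL pL; rewrite !subr_gt0 !ltr_nat; apply/andP; split.
  apply: proper_card; rewrite properE; apply/andP; split.
    by apply/subsetP => L'; rewrite inE => /andP[].
  by apply/subsetPn; exists L; rewrite // inE LL (negPf pL).
by apply: proper_card; rewrite properEneq (line_neq lsE) ?(line_sub lsE).
Qed.

(** With [n] points, [b] lines, [k] points on [L] and [d] lines through [p], the weights compare
    because [n d - b k = n (d - k) + k (n - b)] has nonnegative summands when [b <= n]. Both totals
    are 1, so for every nonincident pair both summands vanish. *)
Lemma de_bruijn_erdos_eq : (1 < #|E|)%N -> (#|Ls| <= #|E|)%N ->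
  #|Ls| = #|E| /\ (forall p L, p \in E -> L \in Ls -> p \notin L -> #|pencil Ls p| = #|L|).
Proof.
move=> E1 bn.
have b0 : (0 < #|Ls|)%N.
  have /card_gt1P[p [q [pE qE pq]]] := E1.
  by have [L [LL _ _]] := line_join lsE pE qE pq; apply/card_gt0P; exists L.
have n0 : 0 < #|E|%:R :> rat by rewrite ltr0n; lia.
have b0' : 0 < #|Ls|%:R :> rat by rewrite ltr0n.
have bn' : #|Ls|%:R <= #|E|%:R :> rat by rewrite ler_nat.
have le (pL : T * {set T}) : nonincident pL ->
  0 <= (#|E|%:R * (#|Ls|%:R - #|pencil Ls pL.1|%:R))^-1
       - (#|Ls|%:R * (#|E|%:R - #|pL.2|%:R))^-1 :> rat.
  case: pL => p L /= /and3P[pE LL pL].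
  have /andP[bd nk] := conway_terms pE LL pL.
  have kd : #|L|%:R <= #|pencil Ls p|%:R :> rat by rewrite ler_nat line_le_pencil.
  have k0 : 0 <= #|L|%:R :> rat by rewrite ler0n.
  have h1 := mulr_ge0 (ltW n0) (etrans (subr_ge0 _ _) kd).
  have h2 := mulr_ge0 k0 (etrans (subr_ge0 _ _) bn').
  by rewrite subr_ge0 lef_pV2 ?posrE ?mulr_gt0 //; lra.
have s0 : \sum_(pL | nonincident pL)
   ((#|E|%:R * (#|Ls|%:R - #|pencil Ls pL.1|%:R))^-1
       - (#|Ls|%:R * (#|E|%:R - #|pL.2|%:R))^-1) == 0 :> rat.
  by rewrite sumrB conway_points // conway_lines // subrr.
rewrite psumr_eq0 // in s0.
have key p L : p \in E -> L \in Ls -> p \notin L ->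
    #|Ls| = #|E| /\ #|pencil Ls p| = #|L|.
  move=> pE LL pL; have /andP[bd nk] := conway_terms pE LL pL.
  move/allP: s0 => /(_ (p, L) (mem_index_enum _)) /=; rewrite pE LL pL /=.
  rewrite subr_eq0 (inj_eq invr_inj) => /eqP e.
  have kd : #|L|%:R <= #|pencil Ls p|%:R :> rat by rewrite ler_nat line_le_pencil.
  have k0 : 0 < #|L|%:R :> rat by rewrite ltr0n; have := line_gt1 lsE LL; lia.
  have [h1 h2] : #|E|%:R * (#|pencil Ls p|%:R - #|L|%:R) == 0 :> rat
      /\ #|L|%:R * (#|E|%:R - #|Ls|%:R) == 0 :> rat.
    have h1 := mulr_ge0 (ltW n0) (etrans (subr_ge0 _ _) kd).
    have h2 := mulr_ge0 (ltW k0) (etrans (subr_ge0 _ _) bn').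
    by split; rewrite eq_le; apply/andP; split; lra.
  move: h1 h2; rewrite !mulf_eq0 (gt_eqF k0) (gt_eqF n0) /= !subr_eq0 !eqr_nat.
  by move=> /eqP -> /eqP ->.
split; last by move=> p L pE LL pL; have [] := key p L pE LL pL.
have /card_gt0P[L LL] := b0.
have [p pE pL] := exists_off_line LL.
by have [] := key p L pE LL pL.
Qed.

Lemma de_bruijn_erdos : (1 < #|E|)%N -> (#|E| <= #|Ls|)%N.
Proof.
move=> E1; rewrite leqNgt; apply/negP => lt.
by have [e _] := de_bruijn_erdos_eq E1 (ltnW lt); lia.
Qed.

(** If [d = k] for all nonincident pairs and [b > n], then [n (b - d)] exceeds [b (n - k)] by
    [k (b - n) > 0], and the two sums of weights cannot both be 1. *)
Lemma card_lines_eq : (1 < #|E|)%N ->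
  (forall p L, p \in E -> L \in Ls -> p \notin L -> #|pencil Ls p| = #|L|) ->
  #|Ls| = #|E|.
Proof.
move=> E1 eqd; apply/eqP; rewrite eqn_leq de_bruijn_erdos // andbT leqNgt; apply/negP => lt.
have lt' : #|E|%:R < #|Ls|%:R :> rat by rewrite ltr_nat.
have : \sum_(pL | nonincident pL) (#|E|%:R * (#|Ls|%:R - #|pencil Ls pL.1|%:R))^-1
   < \sum_(pL | nonincident pL) (#|Ls|%:R * (#|E|%:R - #|pL.2|%:R))^-1 :> rat.
  apply: ltr_sum => [|[p L] /= /and3P[pE LL pL]].
    have /card_gt0P[L LL] : (0 < #|Ls|)%N by lia.
    have [p pE pL] := exists_off_line LL.
    by apply/hasP; exists (p, L); rewrite ?mem_index_enum //= pE LL.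
  have /andP[bd nk] := conway_terms pE LL pL.
  have n0 : 0 < #|E|%:R :> rat by rewrite ltr0n; lia.
  have k0 : 0 < #|L|%:R :> rat by rewrite ltr0n; have := line_gt1 lsE LL; lia.
  rewrite ltf_pV2 ?posrE ?mulr_gt0 //; last by lra.
  rewrite (eqd _ _ pE LL pL) in bd *; nra.
by rewrite conway_points // conway_lines ?ltxx //; lia.
Qed.

Lemma card_pencil_eq p L : p \in E -> L \in Ls -> p \notin L ->
  (forall L', L' \in Ls -> L != L' -> L :&: L' != set0) -> #|pencil Ls p| = #|L|.
Proof.
move=> pE LL pL meet; rewrite -(sum_pencil_meet pE LL pL) -sum1_card.
apply: eq_bigr => L'; rewrite inE => /andP[L'L pL'].
have nLL' : L != L' by apply: contraNneq pL => ->.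
apply/eqP; rewrite eqn_leq card_line_meet // card_gt0 meet //.
Qed.

End LinearSpaceTheory.

(** * Beta invariants of simple rank 3 matroids *)

(** Inserting or deleting a fixed [x] of [A] pairs off subsets of opposite sign. *)
Lemma alternating_sum (T : finType) (A : {set T}) :
  \sum_(S : {set T} | S \subset A) (-1) ^+ #|S| = (A == set0)%:R :> int.
Proof.
have [-> | /set0Pn[x xA]] := eqVneq A set0.
  by rewrite (big_pred1 set0) ?cards0 // => S; rewrite subset0.
rewrite (bigID (fun S : {set T} => x \in S)) /=.
rewrite (reindex_onto (fun S => x |: S) (fun S => S :\ x)) /=; last first.
  by move=> S /andP[_ xS]; rewrite setD1K.
rewrite -[RHS](addNr (\sum_(S : {set T} | (S \subset A) && (x \notin S)) (-1) ^+ #|S|)).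
congr (_ + _); rewrite -sumrN; apply: eq_big => [S|S /andP[_ /eqP eS]].
  rewrite subUset sub1set xA setU11 andbT /=; congr (_ && _).
  by apply/eqP/idP => [<-|/setU1K//]; rewrite setD11.
by rewrite cardsU1 -eS setD11 exprS mulN1r.
Qed.

Section Matroid.
Variables (T : finType) (M : matroid T).
Local Notation E := (ground M).

(* The alternating sum of [S \subset F] over [S \subset E] vanishes when [F] meets [E],
   so only the term in [S == set0] contributes. *)
Lemma beta_expansion a c (s : seq (int * {set T})) :
  E != set0 -> {in s, forall cF, E :&: cF.2 != set0} ->
  (forall S : {set T}, S \subset E -> (rk M S)%:Z =
     a - \sum_(cF <- s) cF.1 * (S \subset cF.2)%:R - c * (S == set0)%:R) ->
  beta M = (-1) ^+ (rank M).+1 * c.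
Proof.
move=> E0 sE rE; rewrite exprS mulN1r mulNr -mulrN; congr (_ * _).
have alt (F : {set T}) : \sum_(S : {set T} | S \subset E) (-1) ^+ #|S| * (S \subset F)%:R
    = (E :&: F == set0)%:R :> int.
  rewrite -alternating_sum big_mkcond [RHS]big_mkcond; apply: eq_bigr => S _.
  by rewrite subsetI; case: (S \subset E) => //; case: (S \subset F); rewrite ?mulr1 ?mulr0.
transitivity (\sum_(S : {set T} | S \subset E) ((-1) ^+ #|S| * (S \subset E)%:R * a
    - \sum_(cF <- s) cF.1 * ((-1) ^+ #|S| * (S \subset cF.2)%:R)
    - c * ((-1) ^+ #|S| * (S \subset set0)%:R))).
  apply: eq_bigr => S SE; rewrite rE // SE mulr1 subset0 !mulrBr mulr_sumr.
  by rewrite (mulrCA c); congr (_ - _ - _); apply: eq_bigr => i _; rewrite mulrCA.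
rewrite !sumrB -mulr_suml alt setIid (negPf E0) mul0r sub0r exchange_big /=.
rewrite big1_seq ?oppr0 ?sub0r => [|cF /andP[_ /sE nz]]; last first.
  by rewrite -mulr_sumr alt (negPf nz) mulr0.
by rewrite -mulr_sumr alt setI0 eqxx mulr1.
Qed.

Lemma rk_set0 : rk M set0 = 0%N.
Proof. by apply/eqP; rewrite -leqn0; have := @rk_card _ M _ (sub0set _); rewrite cards0. Qed.

(** The points of [B] are absorbed one at a time: submodularity is applied to [A :|: B :\ x] and
    [x |: A], whose intersection contains [A]. *)
Lemma rk_setU1_closure (A B : {set T}) : A \subset E -> B \subset E ->
  (forall x, x \in B -> rk M (x |: A) = rk M A) -> rk M (A :|: B) = rk M A.
Proof.
move=> AE; move: {2}#|B| (leqnn #|B|) => m; elim: m B => [|m IH] B.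
  by rewrite leqn0 cards_eq0 => /eqP -> _ _; rewrite setU0.
have [-> | /set0Pn[x xB]] := eqVneq B set0; first by rewrite setU0.
rewrite (cardsD1 x) xB /= add1n ltnS => Bm BE cl.
have B'E : B :\ x \subset E by apply: subset_trans BE; apply: subsetDl.
have e := IH _ Bm B'E (fun y yB => cl y (subsetP (subsetDl _ _) y yB)).
have xAE : x |: A \subset E by rewrite subUset AE sub1set (subsetP BE).
have AB'E : A :|: (B :\ x) \subset E by rewrite subUset AE.
have ABE : A :|: B \subset E by rewrite subUset AE.
apply/eqP; rewrite eqn_leq [X in _ && X]rk_mono ?subsetUl // andbT.
have := rk_submod AB'E xAE; rewrite e cl //.
have -> : A :|: B :\ x :|: (x |: A) = A :|: B.
  apply/setP => y; rewrite !inE; case: eqP => [->|_].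
    by rewrite xB !orbT.
  by rewrite orbAC orbb.
have : (rk M A <= rk M ((A :|: B :\ x) :&: (x |: A)))%N.
  apply: rk_mono; first by rewrite subsetI subsetUl subsetUr.
  by rewrite (subset_trans (subsetIl _ _)).
by lia.
Qed.

Lemma flat_subset (F A : {set T}) : flat M F -> A \subset E ->
  (rk M (F :|: A) <= rk M F)%N -> A \subset F.
Proof.
move=> /andP[FE /forall_inP fl] AE le; apply/subsetP => x xA; apply/negPn/negP => xF.
have := fl x; rewrite inE xF (subsetP AE) // => /(_ isT); rewrite ltnNge => /negP; apply.
apply: leq_trans le; apply: rk_mono; last by rewrite subUset FE.
by rewrite subUset subsetUl andbT sub1set inE xA orbT.
Qed.

Definition rank2_flats := [set L : {set T} | flat M L && (rk M L == 2)%N].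

End Matroid.

(** * The linear space of a simple rank 3 matroid *)

Section SimpleRank3.
Variables (T : finType) (M : matroid T).
Hypotheses (rk3 : rank M = 3%N) (simpleM : simple_matroid M).
Local Notation E := (ground M).
Local Notation Ls := (rank2_flats M).

Lemma simple_rk1 i : i \in E -> rk M [set i] = 1%N.
Proof.
move=> iE; have /andP[/forallP /(_ i) nl _] := simpleM.
have := @rk_card _ M [set i]; rewrite sub1set iE cards1 => /(_ isT).
by move: nl; rewrite /loop iE /=; case: (rk M [set i]) => [|[]].
Qed.

Lemma simple_rk2 i j : i \in E -> j \in E -> i != j -> rk M [set i; j] = 2%N.
Proof.
move=> iE jE ij; have /andP[_ /forallP /(_ i) /forallP /(_ j)] := simpleM.
have sE : [set i; j] \subset E by rewrite subUset !sub1set iE.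
rewrite /parallel iE jE ij /= => n1.
have := rk_card sE; rewrite cards2 ij => le2.
have := @rk_mono _ M [set i] [set i; j]; rewrite subsetUl simple_rk1 // sE => /(_ isT isT).
by move: n1 le2; case: (rk M _) => [|[|[|]]].
Qed.

Lemma rk_le3 (S : {set T}) : S \subset E -> (rk M S <= 3)%N.
Proof. by move=> SE; rewrite -rk3; apply: rk_mono. Qed.

Lemma rank2_flatP L : L \in Ls -> [/\ L \subset E, flat M L & rk M L = 2%N].
Proof. by rewrite inE => /andP[fl /eqP ?]; split => //; case/andP: fl. Qed.

(** The line is the closure [C] of [S], of rank 2 by [rk_setU1_closure]. It is a flat because a
    point that does not raise the rank of [C] does not raise that of [S]. *)
Lemma rk2_line (S : {set T}) : S \subset E -> rk M S = 2%N ->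
  exists2 L, L \in Ls & S \subset L.
Proof.
move=> SE S2; pose C := [set x in E | rk M (x |: S) == 2%N].
have CE : C \subset E by apply/subsetP => x; rewrite inE => /andP[].
have SC : S \subset C.
  by apply/subsetP => x xS; rewrite inE (subsetP SE) // (setUidPr _) ?sub1set // S2 eqxx.
have rC : rk M C = 2%N.
  have <- : S :|: C = C by apply/setUidPr.
  rewrite -S2 rk_setU1_closure // => x; rewrite inE => /andP[_ /eqP ->].
  by rewrite S2.
exists C => //; rewrite inE rC eqxx andbT /flat CE; apply/forall_inP => x.
rewrite !inE => /andP[xC xE]; rewrite xE /= in xC.
have xCE : x |: C \subset E by rewrite subUset sub1set xE.
rewrite rC ltnNge; apply: contra xC => le.
rewrite eqn_leq; apply/andP; split.
  by apply: leq_trans le; apply: rk_mono => //; apply: setUS.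
by rewrite -S2; apply: rk_mono; rewrite ?subsetUr // subUset sub1set xE.
Qed.

(** The intersection of [L] and [S] contains [i] and [j], so it has rank 2, and by submodularity
    their union has rank at most 2; [L] being a flat, it contains [S]. *)
Lemma line_absorbs (S L : {set T}) i j : S \subset E -> rk M S = 2%N -> L \in Ls ->
  i != j -> i \in S -> j \in S -> i \in L -> j \in L -> S \subset L.
Proof.
move=> SE S2 /rank2_flatP[LE fL L2] ij iS jS iL jL; apply: (flat_subset fL SE).
have : (2 <= rk M (L :&: S))%N.
  rewrite -(simple_rk2 (subsetP SE _ iS) (subsetP SE _ jS) ij).
  apply: rk_mono; last by rewrite (subset_trans (subsetIr _ _)).
  by rewrite subUset !sub1set !inE iL iS jL jS.
by have := rk_submod LE SE; rewrite S2 L2; lia.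
Qed.

Lemma rank3_linear_space : linear_space E Ls.
Proof.
have inj (L L' : {set T}) p q : L \in Ls -> L' \in Ls -> p != q ->
    p \in L -> q \in L -> p \in L' -> q \in L' -> L \subset L'.
  by move=> /rank2_flatP[LE _ L2] L'L *; apply: (@line_absorbs _ _ p q).
split=> [L /rank2_flatP[]//|L /rank2_flatP[LE _ L2]|L /rank2_flatP[_ _ L2]|p q pE qE pq|].
- by rewrite -L2 rk_card.
- by apply/eqP => LE; move: rk3; rewrite /rank -LE L2.
- have [||L LL] := @rk2_line [set p; q]; rewrite ?simple_rk2 //.
    by rewrite subUset !sub1set pE.
  by rewrite subUset !sub1set => /andP[pL qL]; exists L.
- move=> L L' p q LL L'L pq pL qL pL' qL'; apply/eqP.
  by rewrite eqEsubset !(@inj _ _ p q).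
Qed.

Let lsE := rank3_linear_space.

(** Gives the indicator of rank 2 in the form that [beta_expansion] asks for: a set with two points
    lies in at most one line, and in one exactly when its rank is 2. *)
Lemma rk_eq2_sum (S : {set T}) : S \subset E -> (1 < #|S|)%N ->
  (\sum_(L in Ls) (S \subset L) = (rk M S == 2))%N.
Proof.
move=> SE /card_gt1P[i [j [iS jS ij]]].
have [S2 | nS2] := eqVneq (rk M S) 2%N; last first.
  rewrite big1 // => L /rank2_flatP[LE fL L2]; apply/eqP; rewrite eqb0.
  apply: contra nS2 => SL; rewrite eqn_leq -{1}L2 rk_mono //=.
  rewrite -(simple_rk2 (subsetP SE _ iS) (subsetP SE _ jS) ij).
  by rewrite rk_mono // subUset !sub1set iS.
have [L LL SL] := rk2_line SE S2.
rewrite (bigD1 L) //= SL big1 // => L' /andP[L'L nLL'].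
apply/eqP; rewrite eqb0; apply: contra nLL' => SL'; apply/eqP.
by apply: (line_inj lsE L'L LL ij); rewrite ?(subsetP SL) ?(subsetP SL').
Qed.

Lemma rk_ge2 (S : {set T}) : S \subset E -> (1 < #|S|)%N -> (2 <= rk M S)%N.
Proof.
move=> SE /card_gt1P[i [j [iS jS ij]]].
rewrite -(simple_rk2 (subsetP SE _ iS) (subsetP SE _ jS) ij).
by rewrite rk_mono // subUset !sub1set iS.
Qed.

Lemma rank3_proper_flat (F : {set T}) : proper_flat M F =
  (F \in Ls) || [exists i in E, F == [set i]].
Proof.
apply/idP/idP => [/and3P[fF F0 FE]|/orP[LF|/exists_inP[i iE /eqP ->]]].
- have sF : F \subset E by case/andP: fF.
  have [F1|F1] := ltnP 1 #|F|.
    rewrite inE fF /= eqn_leq rk_ge2 // andbT.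
    (* A flat of rank 3 contains every point, so it would be the whole ground set. *)
    rewrite leqNgt; apply/orP; left; apply: contra FE => F3.
    by rewrite eqEsubset sF (flat_subset fF) // (setUidPr sF) -/(rank M) rk3.
  have /cards1P[i Fi] : #|F| == 1%N by move: F1 F0; rewrite -cards_eq0; lia.
  by apply/orP; right; apply/exists_inP; exists i; rewrite -?sub1set -?Fi.
- have [FE fF F2] := rank2_flatP LF.
  rewrite /proper_flat fF (line_neq lsE) // -cards_eq0.
  by have := line_gt1 lsE LF; lia.
- have siE : [set i] \subset E by rewrite sub1set.
  rewrite /proper_flat /flat siE /=; apply/and3P; split.
  + apply/forall_inP => j; rewrite !inE => /andP[ji jE].
    by rewrite simple_rk1 // simple_rk2.
  + by rewrite -cards_eq0 cards1.
  + by apply/eqP => e; move: rk3; rewrite /rank -e simple_rk1.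
Qed.

Lemma card_ground_gt2 : (2 < #|E|)%N.
Proof. by rewrite -rk3; apply: rk_card. Qed.

Lemma ground_neq0 : E != set0.
Proof. by rewrite -card_gt0; have := card_ground_gt2; lia. Qed.

(** * Beta invariants of the matroid and of its minors *)

Local Notation valency p := #|pencil Ls p|.

Lemma beta_rank3 : beta M =
  3 - 2 * #|E|%:Z + \sum_(L in Ls) (#|L|%:Z - 1).
Proof.
(* The coefficients are found from large sets down. Subtracting the lines from 3 gives the rank of
   sets with at least two points; at a singleton this leaves 3 minus the valency, so [2 - valency i]
   must be subtracted to reach 1; [c] is what then remains at the empty set. *)
pose s := [seq (1 : int, L) | L <- enum Ls]
  ++ [seq (2 - (valency i)%:Z, [set i]) | i <- enum E].
pose c : int := 3 - #|Ls|%:Z - \sum_(i in E) (2 - (valency i)%:Z).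
have -> : 3 - 2 * #|E|%:Z + \sum_(L in Ls) (#|L|%:Z - 1) = c.
  rewrite /c !sumrB !sumr_const -[2 *+ _]mulr_natr.
  have -> : \sum_(L in Ls) #|L|%:Z = \sum_(i in E) (valency i)%:Z.
    under eq_bigr do rewrite -natz; under [RHS]eq_bigr do rewrite -natz.
    by rewrite -!natr_sum (sum_card_line lsE).
  by rewrite !natz; ring.
rewrite (@beta_expansion _ M 3 c s) ?rk3 ?mul1r ?ground_neq0 //.
- move=> cF; rewrite mem_cat => /orP[] /mapP[x]; rewrite mem_enum => xE -> /=.
    rewrite (setIidPr (line_sub lsE xE)) -card_gt0.
    by have := line_gt1 lsE xE; lia.
  by apply/set0Pn; exists x; rewrite !inE xE eqxx.
- move=> S SE; rewrite big_cat !big_map !big_enum /=.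
  have [->|S0] := eqVneq S set0.
    have -> : \sum_(L in Ls) 1 * (set0 \subset L)%:R = #|Ls|%:Z.
      by rewrite (eq_bigr (fun=> 1)) ?sumr_const ?natz // => L _; rewrite sub0set.
    have -> : \sum_(i in E) (2 - (valency i)%:Z) * (set0 \subset [set i])%:R
        = \sum_(i in E) (2 - (valency i)%:Z).
      by under eq_bigr do rewrite sub0set mulr1.
    by rewrite rk_set0 mulr1 /c; ring.
  rewrite mulr0 subr0; under eq_bigr do rewrite mul1r.
  have [S1|S1] := ltnP 1 #|S|.
    rewrite -natr_sum rk_eq2_sum // big1 ?addr0 => [|i iE].
      by have := rk_ge2 SE S1; have := rk_le3 SE; case: (rk M S) => [|[|[|[|]]]].
    case: (boolP (S \subset _)) => [/subset_leq_card|_]; last by rewrite mulr0.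
    by rewrite cards1 leqNgt S1.
  have /cards1P[i Si] : #|S| == 1%N by move: S1 S0; rewrite -cards_eq0; lia.
  have iE : i \in E by rewrite -sub1set -Si.
  rewrite Si simple_rk1 // (bigD1 i) //= subxx mulr1.
  rewrite [X in _ + (_ + X)]big1 => [|j /andP[_ ji]].
    under eq_bigr do rewrite sub1set.
    by rewrite -natr_sum -card_pencil natz; ring.
  by rewrite sub1set inE eq_sym (negPf ji) mulr0.
Qed.

Lemma ground_minor (A B : {set T}) : A \subset E ->
  ground (contract (restrict M A) B) = A :\: B.
Proof. by move=> AE; rewrite /contract /restrict /= (setIidPl AE). Qed.

Lemma rk_minor (A B S : {set T}) : A \subset E -> B \subset A ->
  rk (contract (restrict M A) B) S = (rk M (S :|: B) - rk M B)%N.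
Proof.
by move=> AE BA; rewrite /contract /restrict /= /contract_rk /= (setIidPl AE) (setIidPl BA).
Qed.

Lemma rank_minor (A B : {set T}) : A \subset E -> B \subset A ->
  rank (contract (restrict M A) B) = (rk M A - rk M B)%N.
Proof.
move=> AE BA; rewrite /rank ground_minor // rk_minor //.
by rewrite setUC setDE setUIr setUCr setIT (setUidPr BA).
Qed.

Lemma beta_restrict_ground : beta (contract (restrict M E) set0) = beta M.
Proof.
rewrite /beta rank_minor ?sub0set // ground_minor // setD0 rk_set0 subn0.
by congr (_ * _); apply: eq_bigr => S _; rewrite rk_minor ?sub0set // setU0 rk_set0 subn0.
Qed.

Lemma beta_restrict_point i : i \in E -> beta (contract (restrict M [set i]) set0) = 1.
Proof.
move=> iE; have siE : [set i] \subset E by rewrite sub1set.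
rewrite (@beta_expansion _ _ 1 1 [::]) ?rank_minor ?ground_minor ?sub0set ?setD0 //.
- by rewrite simple_rk1 // rk_set0.
- by apply/set0Pn; exists i; rewrite inE.
- move=> S SE; rewrite rk_minor ?sub0set // setU0 rk_set0 subn0 big_nil.
  have [->|S0] := eqVneq S set0; first by rewrite rk_set0.
  by move: SE; rewrite subset1 (negPf S0) orbF => /eqP ->; rewrite simple_rk1.
Qed.

(** Contracting a rank 2 flat leaves a loopless matroid of rank 1, whose rank function is 1 minus
    the indicator of the empty set. *)
Lemma beta_contract_line L : L \in Ls -> beta (contract (restrict M E) L) = 1.
Proof.
move=> LL; have [LE fL L2] := rank2_flatP LL.
rewrite (@beta_expansion _ _ 1 1 [::]) ?rank_minor ?ground_minor //.
- by rewrite L2 -/(rank M) rk3.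
- by rewrite setD_eq0; apply: contra (line_neq lsE LL) => EL; rewrite eqEsubset EL LE.
- move=> S; rewrite subsetD => /andP[SE dS]; rewrite rk_minor // L2 big_nil.
  have [->|/set0Pn[x xS]] := eqVneq S set0; first by rewrite set0U L2.
  have SLE : S :|: L \subset E by rewrite subUset SE.
  have : (2 < rk M (S :|: L))%N.
    rewrite ltnNge; apply/negP => le.
    have /subsetP/(_ x xS) : S \subset L by apply: (flat_subset fL SE); rewrite setUC L2.
    by apply/negP; apply: contraTN dS => xL; apply/pred0Pn; exists x; rewrite /= xS.
  by have := rk_le3 SLE; case: (rk M _) => [|[|[|[|]]]].
Qed.

(** [M|L] is uniform of rank 2: its rank function is 2, less 1 on each singleton, less [2 - #|L|]
    more at the empty set, where all singletons contribute. *)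
Lemma beta_restrict_line L : L \in Ls ->
  beta (contract (restrict M L) set0) = #|L|%:Z - 2.
Proof.
move=> LL; have [LE fL L2] := rank2_flatP LL.
rewrite (@beta_expansion _ _ 2 (2 - #|L|%:Z) [seq (1, [set i]) | i <- enum L])
  ?rank_minor ?ground_minor ?sub0set ?setD0 //.
- by rewrite L2 rk_set0; ring.
- by rewrite -card_gt0; have := line_gt1 lsE LL; lia.
- move=> cF /mapP[x]; rewrite mem_enum => xL -> /=.
  by apply/set0Pn; exists x; rewrite !inE xL eqxx.
- move=> S SL; have SE := subset_trans SL LE.
  rewrite rk_minor ?sub0set // setU0 rk_set0 subn0 big_map big_enum /=.
  under eq_bigr do rewrite mul1r.
  have [->|S0] := eqVneq S set0.
    rewrite rk_set0 (eq_bigr (fun=> 1)) => [|j _]; last by rewrite sub0set.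
    by rewrite sumr_const natz mulr1; ring.
  rewrite mulr0 subr0.
  have [S1|S1] := ltnP 1 #|S|.
    rewrite big1 => [|i _].
      suff -> : rk M S = 2%N by [].
      by apply/eqP; rewrite eqn_leq rk_ge2 // -{1}L2 rk_mono.
    case: (boolP (S \subset _)) => [/subset_leq_card|//].
    by rewrite cards1 leqNgt S1.
  have /cards1P[i Si] : #|S| == 1%N by move: S1 S0; rewrite -cards_eq0; lia.
  have iL : i \in L by rewrite -sub1set -Si.
  rewrite Si simple_rk1 ?(subsetP LE) // (bigD1 i) //= subxx big1 // => j /andP[_ ji].
  by rewrite sub1set inE eq_sym (negPf ji).
Qed.

(** The parallel classes of [M/i] are the sets [L :\ i] for the lines [L] through [i]; these lines
    play the part that the points play in [M|L]. *)
Lemma beta_contract_point i : i \in E ->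
  beta (contract (restrict M E) [set i]) = (valency i)%:Z - 2.
Proof.
move=> iE; have siE : [set i] \subset E by rewrite sub1set.
rewrite (@beta_expansion _ _ 2 (2 - (valency i)%:Z) [seq (1, L) | L <- enum (pencil Ls i)])
  ?rank_minor ?ground_minor //.
- by rewrite -/(rank M) rk3 simple_rk1 //; ring.
- by rewrite -card_gt0 cardsDS // cards1; have := card_ground_gt2; lia.
- move=> cF /mapP[L]; rewrite mem_enum inE => /andP[LL iL] -> /=.
  rewrite setIC setIDA (setIidPl (line_sub lsE LL)) -card_gt0.
  by rewrite cardsDS ?sub1set // cards1; have := line_gt1 lsE LL; lia.
- move=> S; rewrite subsetD => /andP[SE]; rewrite disjoint_sym disjoints1 => iS.
  rewrite rk_minor // simple_rk1 // big_map big_enum /=.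
  under eq_bigr do rewrite mul1r.
  have [->|S0] := eqVneq S set0.
    rewrite set0U simple_rk1 // (eq_bigr (fun=> 1)) => [|L _]; last by rewrite sub0set.
    by rewrite sumr_const subnn !natz mulr1 subrr.
  rewrite mulr0 subr0.
  have SiE : S :|: [set i] \subset E by rewrite subUset SE.
  have Si1 : (1 < #|S :|: [set i]|)%N.
    by rewrite setUC cardsU1 iS; move: S0; rewrite -card_gt0; lia.
  (* A line through [i] contains [S] exactly when it contains [S :|: [set i]], which has at least
     two points, so that [rk_eq2_sum] applies. *)
  have -> : \sum_(L in pencil Ls i) (S \subset L)%:R
      = (\sum_(L in Ls) (S :|: [set i] \subset L))%N%:R :> int.
    rewrite natr_sum big_mkcond [RHS]big_mkcond; apply: eq_bigr => L _.
    rewrite inE subUset sub1set.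
    by case: (L \in Ls); case: (i \in L); rewrite ?andbT ?andbF.
  rewrite rk_eq2_sum //.
  by have := rk_ge2 SiE Si1; have := rk_le3 SiE; case: (rk M _) => [|[|[|[|]]]].
Qed.

End SimpleRank3.

(** * The Chow ring in rank 3 *)

Section EvalAlong.
Variables (n : nat) (v : 'I_n -> int).
Implicit Types (p : {mpoly int[n]}) (m : 'X_{1..n}).

(** Restriction of a polynomial to the line spanned by [v]: the coefficient of ['X^k] is the value
    at [v] of the homogeneous part of degree [k]. *)
Definition eval_along : {rmorphism {mpoly int[n]} -> {poly int}} :=
  mmap polyC (fun i => v i *: 'X).

Lemma eval_alongX i : eval_along 'X_i = v i *: 'X.
Proof. by rewrite /eval_along /= mmapX mmap1U. Qed.

Lemma eval_along_coef p k :
  (eval_along p)`_k = \sum_(m <- msupp p | mdeg m == k) p@_m * mmap1 v m.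
Proof.
rewrite /eval_along /= /mmap coef_sum [RHS]big_mkcond; apply: eq_bigr => m _.
rewrite coefCM /mmap1; under eq_bigr do rewrite exprZn.
rewrite scaler_prod prodrXr -mdegE coefZ coefXn eq_sym.
by case: eqP; rewrite ?mulr1 ?mulr0.
Qed.

Lemma eval_along_coef0 p : (eval_along p)`_0 = p@_0.
Proof.
rewrite eval_along_coef (eq_bigl (pred1 0%MM)) => [|m]; last by rewrite mdeg_eq0.
have [z|/memN_msupp_eq0 z] := boolP (0%MM \in msupp p); last first.
  by rewrite z big1 // => m /eqP ->; rewrite z mul0r.
rewrite -big_filter filter_pred1_uniq ?msupp_uniq // big_seq1 /mmap1 big1 ?mulr1 //.
by move=> i _; rewrite mnm0E.
Qed.

Lemma eval_along_homog p k l : p \is k.-homog -> k != l -> (eval_along p)`_l = 0.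
Proof.
move=> /dhomogP hp kl; rewrite eval_along_coef big_seq_cond big_pred0 // => m.
by apply: contraNF kl => /andP[/hp <-].
Qed.

End EvalAlong.

(** * A degree functional on polynomials that vanishes on the Chow ideal *)

Section ChowRank3.
Variables (T : finType) (M : matroid T).
Hypotheses (rk3 : rank M = 3%N) (simpleM : simple_matroid M).
Local Notation E := (ground M).
Local Notation Ls := (rank2_flats M).
Local Notation P := {mpoly int[#|{: pflat M}|]}.
Implicit Types (F G : pflat M) (L : {set T}) (i j : T).

Let lsE := rank3_linear_space rk3 simpleM.

Lemma dim_rank3 : Defs.dim M = 2%N.
Proof. by rewrite /Defs.dim rk3. Qed.

Lemma pflatP F : val F \in Ls \/ exists2 i, i \in E & val F = [set i].
Proof.
have := valP F; rewrite (rank3_proper_flat rk3 simpleM).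
by case/orP => [|/exists_inP[i iE /eqP]]; [left | right; exists i].
Qed.

Lemma line_pflat L : L \in Ls -> exists F, val F = L.
Proof.
move=> LL; have fL : proper_flat M L by rewrite rank3_proper_flat ?LL.
by exists (exist _ L fL).
Qed.

Lemma point_pflat i : i \in E -> exists F, val F = [set i].
Proof.
move=> iE; have fi : proper_flat M [set i].
  by rewrite rank3_proper_flat //; apply/orP; right; apply/exists_inP; exists i.
by exists (exist _ [set i] fi).
Qed.

Lemma point_notin_lines i : [set i] \notin Ls.
Proof. by apply/negP => /(line_gt1 lsE); rewrite cards1. Qed.

Lemma mem_pflat F i : i \in val F -> i \in E.
Proof. by case/and3P: (valP F) => /andP[/subsetP FE _] _ _; apply: FE. Qed.

Lemma sum_pflat_mem (V : nmodType) (g : pflat M -> V) i Fi : val Fi = [set i] ->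
  \sum_(F : pflat M | i \in val F) g F
  = g Fi + \sum_(F : pflat M | (val F \in Ls) && (i \in val F)) g F.
Proof.
move=> ei; rewrite (bigD1 Fi) /=; last by rewrite ei inE.
congr (_ + _); apply: eq_bigl => F; rewrite andbC.
case: (boolP (i \in val F)) => [iF|]; last by rewrite !andbF.
rewrite !andbT; case: (pflatP F) => [FL|[j jE ej]].
  by rewrite FL; apply: contraTneq FL => ->; rewrite ei point_notin_lines.
rewrite ej (negPf (point_notin_lines _)); apply/negbF/eqP/val_inj.
by move: iF; rewrite ei ej inE => /eqP ->.
Qed.

Lemma sum_pflat_lines (V : nmodType) (g : {set T} -> V) (Q : pred {set T}) :
  \sum_(F : pflat M | (val F \in Ls) && Q (val F)) g (val F) = \sum_(L in Ls | Q L) g L.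
Proof.
transitivity (\sum_(L | proper_flat M L && ((L \in Ls) && Q L)) g L).
  exact: (esym (big_sub_cond (proper_flat M) (fun L => (L \in Ls) && Q L) g)).
apply: eq_bigl => L; rewrite andbA; congr (_ && _).
by rewrite rank3_proper_flat //; case: (L \in Ls); rewrite ?andbF.
Qed.

Lemma sum_pflat_all_lines (V : nmodType) (g : {set T} -> V) :
  \sum_(F : pflat M | val F \in Ls) g (val F) = \sum_(L in Ls) g L.
Proof.
rewrite (eq_bigl (fun F => (val F \in Ls) && predT (val F))) => [|F]; last by rewrite andbT.
by rewrite sum_pflat_lines; apply: eq_bigl => L; rewrite andbT.
Qed.

Lemma incomparable_lines F G : val F \in Ls -> val G \in Ls -> F != G ->
  incomparable F G.
Proof.
move=> FL GL nFG; have neq : val F != val G by apply: contra nFG => /eqP/val_inj ->.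
have h (L1 L2 : {set T}) : L1 \in Ls -> L2 \in Ls -> L1 != L2 -> ~~ (L1 \subset L2).
  move=> L1L L2L; apply: contra => s12.
  have /card_gt1P[p [q [p1 q1 pq]]] := line_gt1 lsE L1L.
  by apply/eqP; apply: (line_inj lsE L1L L2L pq); rewrite ?(subsetP s12).
by rewrite /incomparable !h // eq_sym.
Qed.

Lemma incomparable_point_line F G i : val F = [set i] -> val G \in Ls ->
  i \notin val G -> incomparable F G.
Proof.
move=> ei GL iG; rewrite /incomparable ei sub1set iG subset1 negb_or.
rewrite -cards_eq0; have := line_gt1 lsE GL => c1.
by rewrite -lt0n (ltn_trans _ c1) // andbT; apply: contraTneq c1 => ->; rewrite cards1.
Qed.

Lemma incomparable_points F G i j : val F = [set i] -> val G = [set j] ->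
  i != j -> incomparable F G.
Proof. by move=> ei ej ij; rewrite /incomparable ei ej !sub1set !inE [j == i]eq_sym ij. Qed.

(* The substitutions [x_i := a - \sum_(L \ni i) y_L] and [x_L := y_L] satisfy the
   linear relations and turn the degree into the diagonal quadratic form
   [a ^ 2 - \sum_L y_L ^ 2]; these are their restrictions to the coordinate axes. *)
Definition point_coord F : int := (val F \notin Ls)%:R.
Definition line_coord L F : int :=
  if val F \in Ls then (val F == L)%:R else - (val F \subset L)%:R.

Definition subst_along (v : pflat M -> int) := 
  eval_along (fun k : 'I_#|{: pflat M}| => v (enum_val k)).

(** Products of two different classes among [a] and the [y_L] have degree 0, so the degree only sees
    the coefficients of the squares: [a ^ 2] counts 1 and each [y_L ^ 2] counts -1. *)
Definition degree_form (p : P) : int :=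
  (subst_along point_coord p)`_2 - \sum_(L in Ls) (subst_along (line_coord L) p)`_2.

Lemma subst_along_pvar v F : subst_along v (pvar F) = v F *: 'X.
Proof. by rewrite /subst_along /pvar eval_alongX enum_rankK. Qed.

Lemma degree_form_zmod_morphism : zmod_morphism degree_form.
Proof.
move=> p q; rewrite /degree_form rmorphB coefB; under eq_bigr do rewrite rmorphB coefB.
by rewrite sumrB; ring.
Qed.

HB.instance Definition _ :=
  GRing.isZmodMorphism.Build P int degree_form degree_form_zmod_morphism.

Definition pairing F G : int :=
  point_coord F * point_coord G - \sum_(L in Ls) line_coord L F * line_coord L G.

(** Only the constant term of [c] keeps the product in degree 2. *)
Lemma degree_form_mul2 (c : P) F G :
  degree_form (c * (pvar F * pvar G)) = c@_0 * pairing F G.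
Proof.
have h v : (subst_along v (c * (pvar F * pvar G)))`_2 = c@_0 * (v F * v G).
  rewrite !rmorphM /= !subst_along_pvar -scalerAl -!scalerAr scalerA coefZ mulrA.
  by rewrite coefMX /= coefMX /= /subst_along eval_along_coef0 mulrC.
rewrite /degree_form h; under eq_bigr do rewrite h.
by rewrite -mulr_sumr -mulrBr.
Qed.

Lemma pairing_incomparable F G : incomparable F G -> pairing F G = 0.
Proof.
(* For a point and a line, only the axis of that line contributes. *)
have pl A B i : val A = [set i] -> val B \in Ls ->
    \sum_(L in Ls) line_coord L A * line_coord L B = - (i \in val B)%:R.
  move=> eA BL; rewrite (bigD1 (val B)) //= big1 => [|L /andP[_ LB]].
    by rewrite /line_coord eA BL (negPf (point_notin_lines _)) eqxx mulr1 addr0 sub1set.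
  by rewrite [line_coord L B]/line_coord BL eq_sym (negPf LB) mulr0.
rewrite /pairing /point_coord.
case: (pflatP F) => [FL|[i iE ei]]; case: (pflatP G) => [GL|[j jE ej]] inc.
- rewrite FL GL mul0r big1 ?subr0 // => L LL; rewrite /line_coord FL GL.
  have [e|] := eqVneq (val F) L; last by rewrite mul0r.
  have [e'|] := eqVneq (val G) L; last by rewrite mulr0.
  by move: inc; rewrite /incomparable e e' subxx.
- under eq_bigr do rewrite mulrC.
  rewrite (pl _ _ _ ej FL) FL /= mul0r sub0r opprK.
  by move: inc; rewrite /incomparable ej sub1set => /andP[_ /negPf ->].
- rewrite (pl _ _ _ ei GL) GL /= mulr0 sub0r opprK.
  by move: inc; rewrite /incomparable ei sub1set => /andP[/negPf ->].
(* For two points, the 1 from the [a] axis is cancelled by the unique line through both. *)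
- have ij : i != j by move: inc; rewrite /incomparable ei ej sub1set inE => /andP[].
  rewrite ei ej !point_notin_lines mulr1.
  have -> : \sum_(L in Ls) line_coord L F * line_coord L G
      = (\sum_(L in pencil Ls i) (j \in L))%N%:R.
    rewrite natr_sum big_mkcond [RHS]big_mkcond; apply: eq_bigr => L _.
    rewrite [L \in pencil _ _]inE /line_coord ei ej.
    rewrite !(negPf (point_notin_lines _)) !sub1set mulrNN.
    by case: (L \in Ls) => //=; case: (i \in L); rewrite ?mul1r ?mul0r.
  by rewrite (lines_through lsE).
Qed.

Lemma sum_point_coord i : i \in E -> \sum_(F : pflat M | i \in val F) point_coord F = 1.
Proof.
move=> iE; have [Fi ei] := point_pflat iE; rewrite (sum_pflat_mem _ ei).
rewrite big1 => [|F /andP[FL _]]; last by rewrite /point_coord FL.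
by rewrite /point_coord ei point_notin_lines addr0.
Qed.

(** If [i] lies on [L], the coordinate -1 of the point cancels the coordinate 1 of [L]; otherwise
    all terms are 0. *)
Lemma sum_line_coord L i : L \in Ls -> i \in E ->
  \sum_(F : pflat M | i \in val F) line_coord L F = 0.
Proof.
move=> LL iE; have [Fi ei] := point_pflat iE; rewrite (sum_pflat_mem _ ei).
rewrite {1}/line_coord ei (negPf (point_notin_lines _)) sub1set.
rewrite (eq_bigr (fun F => (val F == L)%:R)) => [|F /andP[FL _]]; last first.
  by rewrite /line_coord FL.
rewrite (sum_pflat_lines (fun K => (K == L)%:R) (fun K => i \in K)).
rewrite big_mkcondr (bigD1 L) //= eqxx big1 ?addr0 => [|K /andP[_ /negPf ->]]; last first.
  by case: ifP.
by case: (i \in L); rewrite ?addNr ?oppr0 ?addr0.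
Qed.

(** The linear relations vanish under each substitution separately, while a product of incomparable
    variables is killed only by the combined form, through [pairing_incomparable]. *)
Lemma degree_form_ideal (p : P) : p \in @chow_ideal T M -> degree_form p = 0.
Proof.
move=> /asboolP[c ->]; rewrite raddf_sum big1 // => k _ /=.
have : (chow_rels M)`_k \in chow_rels M by rewrite mem_nth.
rewrite mem_cat => /orP[] /mapP[].
  move=> [F G]; rewrite mem_enum inE /= => inc ->.
  by rewrite degree_form_mul2 pairing_incomparable ?mulr0.
move=> [i j]; rewrite mem_enum inE /= => /andP[iE jE] ->.
have h v : (forall i, i \in E -> \sum_(F : pflat M | i \in val F) v F
       = \sum_(F : pflat M | j \in val F) v F) ->
     subst_along v (c k * (\sum_(F : pflat M | i \in val F) pvar F
       - \sum_(F : pflat M | j \in val F) pvar F)) = 0.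
  move=> hv; rewrite rmorphM rmorphB !rmorph_sum /=.
  under eq_bigr do rewrite subst_along_pvar.
  under [X in _ - X]eq_bigr do rewrite subst_along_pvar.
  by rewrite -!scaler_suml hv // subrr mulr0.
rewrite /degree_form h ?coef0 ?sub0r => [|i' iE']; last by rewrite !sum_point_coord.
rewrite big1 ?oppr0 // => L LL; rewrite h ?coef0 // => i' iE'.
by rewrite !sum_line_coord.
Qed.

End ChowRank3.

Lemma mdeg2P n (m : 'X_{1..n}) : mdeg m = 2%N ->
  exists i j, 'X_[m] = 'X_i * 'X_j :> {mpoly int[n]}.
Proof.
move=> m2; have [i mi|m0] := pickP (fun i => 0 < m i)%N; last first.
  by move: m2; rewrite mdegE big1 // => i _; apply/eqP; rewrite -leqn0 leqNgt m0.
have le : (U_(i) <= m)%MM by rewrite lep1mP -lt0n.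
have e : m = (m - U_(i) + U_(i))%MM by rewrite submK.
have /mdeg1P[j /eqP mj] : mdeg (m - U_(i)) == 1%N.
  by move: m2; rewrite {1}e mdegD mdeg1; lia.
by exists j, i; rewrite {1}e mj mpolyXD.
Qed.

(** * The degree map and the class of the first CSM cycle *)

Section ChowDegree.
Variables (T : finType) (M : matroid T).
Hypotheses (rk3 : rank M = 3%N) (simpleM : simple_matroid M).
Local Notation E := (ground M).
Local Notation Ls := (rank2_flats M).
Implicit Types (F G H : pflat M) (L : {set T}) (i j k : T).

Let lsE := rank3_linear_space rk3 simpleM.
Let dim2 := dim_rank3 rk3.
Local Notation valency p := #|pencil Ls p|.

Definition alpha i : chow M := \sum_(F : pflat M | i \in val F) xvar F.

Lemma alphaE i j : i \in E -> j \in E -> alpha i = alpha j.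
Proof. exact: xvar_linear. Qed.

Lemma xvar_incomparable_sym F G : incomparable F G -> xvar G * xvar F = 0.
Proof. by move=> FG; rewrite mulrC xvar_incomparable. Qed.

(** Represent [alpha] by a point [j] off the line: every flat containing [j] is incomparable with
    it. *)
Lemma alpha_line i G : i \in E -> val G \in Ls -> alpha i * xvar G = 0.
Proof.
move=> iE GL; have [j jE jG] := exists_off_line lsE GL.
rewrite (alphaE iE jE) mulr_suml big1 // => F jF; apply: xvar_incomparable.
case: (pflatP rk3 simpleM F) => [FL|[k kE ek]].
  by apply: (incomparable_lines rk3 simpleM FL GL) => //; apply: contraNneq jG => <-.
apply: (incomparable_point_line rk3 simpleM ek GL).
by move: jF jG; rewrite ek inE => /eqP ->.
Qed.

(** Represent [alpha] by a second point [k] of the line [F]: among the flats containing [k], only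
    [F] is comparable with the point [j]. *)
Lemma alpha_point i j F G : i \in E -> val G = [set j] -> val F \in Ls ->
  j \in val F -> alpha i * xvar G = xvar F * xvar G.
Proof.
move=> iE eG FL jF.
have [k kF kj] : exists2 k, k \in val F & k != j.
  have /card_gt1P[p [q [pF qF pq]]] := line_gt1 lsE FL.
  by have [e|] := eqVneq p j; [exists q; rewrite // -e eq_sym | exists p].
rewrite (alphaE iE (mem_pflat kF)) mulr_suml (bigD1 F) //= big1 ?addr0 //.
move=> H /andP[kH HF]; case: (pflatP rk3 simpleM H) => [HL|[l lE el]].
  apply: xvar_incomparable_sym; apply: (incomparable_point_line rk3 simpleM eG HL).
  apply: contra HF => jH; apply/eqP/val_inj.
  exact: (line_inj lsE HL FL kj).
apply: xvar_incomparable; apply: (incomparable_points el eG).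
by move: kH; rewrite el inE => /eqP <-.
Qed.

(** Expand [alpha j * xvar F = 0]: only the point [j] and [F] itself give nonzero products. *)
Lemma line_sq i j F G : i \in E -> val G = [set j] -> val F \in Ls ->
  j \in val F -> xvar F * xvar F = - (alpha i * xvar G).
Proof.
move=> iE eG FL jF; rewrite (alpha_point iE eG FL jF).
have := alpha_line (mem_pflat jF) FL; rewrite /alpha (sum_pflat_mem rk3 simpleM _ eG).
rewrite mulrDl mulr_suml (bigD1 F) ?FL //= big1 => [|H /andP[/andP[HL _] HF]]; last first.
  by apply: xvar_incomparable; apply: (incomparable_lines rk3 simpleM HL FL).
by rewrite addr0 addrC => /eqP; rewrite addr_eq0 [xvar G * _]mulrC => /eqP.
Qed.

Lemma lines_mul F G : val F \in Ls -> val G \in Ls -> F != G -> xvar F * xvar G = 0.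
Proof.
by move=> FL GL FG; apply: xvar_incomparable; apply: (incomparable_lines rk3 simpleM FL GL).
Qed.

Lemma point_line_mul F G j : val G = [set j] -> val F \in Ls -> j \notin val F ->
  xvar G * xvar F = 0.
Proof.
move=> eG FL jF; apply: xvar_incomparable; exact: (incomparable_point_line rk3 simpleM eG FL).
Qed.

Lemma points_mul F G i j : val F = [set i] -> val G = [set j] -> i != j ->
  xvar F * xvar G = 0.
Proof. by move=> eF eG ij; apply: xvar_incomparable; apply: (incomparable_points eF eG). Qed.

(** For distinct points, both sides are minus the square of the class of the joining line. *)
Lemma alpha_points i j k F G : i \in E -> val F = [set j] -> val G = [set k] ->
  alpha i * xvar F = alpha i * xvar G.
Proof.
move=> iE eF eG; have [e|jk] := eqVneq j k.
  by have -> : F = G by apply/val_inj; rewrite /= eF eG e.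
have jE : j \in E by apply: (@mem_pflat _ _ F); rewrite eF inE.
have kE : k \in E by apply: (@mem_pflat _ _ G); rewrite eG inE.
have [L [LL jL kL]] := line_join lsE jE kE jk.
have [H eH] := line_pflat rk3 simpleM LL; rewrite -eH in LL jL kL.
by apply: oppr_inj; rewrite -(line_sq iE eF LL jL) -(line_sq iE eG LL kL).
Qed.

(** Shows that degree 2 is generated by the single class [alpha i * xvar G]. *)
Lemma xvar_mul_multiple i G j F1 F2 : i \in E -> val G = [set j] ->
  exists z : int, xvar F1 * xvar F2 = (alpha i * xvar G) *~ z.
Proof.
move=> iE eG; set e := alpha i * xvar G.
have pl F H k : val F = [set k] -> val H \in Ls -> exists z : int, xvar F * xvar H = e *~ z.
  move=> eF HL; have [kH|kH] := boolP (k \in val H); last first.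
    by exists 0; rewrite mulr0z (point_line_mul eF HL kH).
  by exists 1; rewrite mulr1z mulrC -(alpha_point iE eF HL kH) (alpha_points iE eF eG).
case: (pflatP rk3 simpleM F1) => [L1|[k1 k1E e1]];
  case: (pflatP rk3 simpleM F2) => [L2|[k2 k2E e2]].
- have [->|nF] := eqVneq F1 F2; last by exists 0; rewrite mulr0z lines_mul.
  have /card_gt1P[p [_ [pF _ _]]] := line_gt1 lsE L2.
  have [H eH] := point_pflat rk3 simpleM (mem_pflat pF).
  by exists (-1); rewrite mulrNz mulr1z (line_sq iE eH L2 pF) (alpha_points iE eH eG).
- by have [z ez] := pl _ _ _ e2 L1; exists z; rewrite mulrC.
- exact: pl e1 L2.
- have [e12|nk] := eqVneq k1 k2; last by exists 0; rewrite mulr0z (points_mul e1 e2).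
  have -> : F2 = F1 by apply/val_inj; rewrite /= e1 e2 e12.
  (* The square of a point class is isolated in this expansion, whose other terms are products of a
     point and a line. *)
  have : alpha k1 * xvar F1 = e.
    by rewrite (alphaE k1E iE) (alpha_points iE e1 eG).
  rewrite /alpha (sum_pflat_mem rk3 simpleM _ e1) mulrDl mulr_suml => /eqP.
  rewrite eq_sym -subr_eq => /eqP <-.
  suff [z ->] : exists z : int,
      \sum_(F : pflat M | (val F \in Ls) && (k1 \in val F)) xvar F * xvar F1 = e *~ z.
    by exists (1 - z); rewrite mulrzBr mulr1z.
  apply: (big_ind (fun x => exists z : int, x = e *~ z))
    => [|x y [zx ->] [zy ->]|F /andP[FL _]].
  + by exists 0; rewrite mulr0z.
  + by exists (zx + zy); rewrite mulrzDr.
  + by have [z ez] := pl _ _ _ e1 FL; exists z; rewrite mulrC.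
Qed.

Definition chow_degree (a : chow M) : int := degree_form (repr a).

(** Well-definedness on the quotient: [repr] changes [p] by an element of the ideal. *)
Lemma chow_degree_proj p : chow_degree (chow_proj p) = degree_form p.
Proof.
apply/eqP; rewrite -subr_eq0 -raddfB /=; apply/eqP/(degree_form_ideal rk3 simpleM).
by rewrite Quotient.idealrBE reprK.
Qed.

Lemma chow_degree_zmod_morphism : zmod_morphism chow_degree.
Proof.
have projK (a : chow M) : a = chow_proj (repr a) by rewrite /chow_proj reprK.
move=> a b; rewrite [a]projK [b]projK -rmorphB !chow_degree_proj.
exact: raddfB.
Qed.

Lemma pairing_flag F G j : val F = [set j] -> val G \in Ls -> j \in val G -> pairing F G = 1.
Proof.
move=> eF GL jG; rewrite /pairing /point_coord GL mulr0 sub0r.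
rewrite (bigD1 (val G)) //= big1 => [|L /andP[_ LG]].
  rewrite /line_coord eF GL (negPf (point_notin_lines rk3 simpleM _)) eqxx.
  by rewrite mulr1 addr0 sub1set jG opprK.
by rewrite [line_coord L G]/line_coord GL eq_sym (negPf LG) mulr0.
Qed.

Lemma xmonE (sigma : cone M (Defs.dim M)) : exists F G j,
  [/\ xmon sigma = xvar F * xvar G, val F = [set j], val G \in Ls & j \in val G].
Proof.
rewrite /xmon; have : size (flats_of sigma) = 2%N by rewrite size_tuple dim2.
have := valP sigma; rewrite /is_chain -/(flats_of sigma).
case: (flats_of sigma) => [|F [|G []]] //=; rewrite andbT /flat_lt => FG _.
have [j jF] : exists j, j \in val F by apply/set0Pn; case/and3P: (valP F).
have GL : val G \in Ls.
  case: (pflatP rk3 simpleM G) => // -[k kE eG]; move: FG; rewrite eG properE subset1.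
  case/andP => /orP[] /eqP eF; rewrite ?eF ?subxx //.
  by move: jF; rewrite eF inE.
have jG : j \in val G by apply: (subsetP (proper_sub FG)).
exists F, G, j; split => //; first by rewrite !big_cons big_nil mulr1.
case: (pflatP rk3 simpleM F) => [FL|[k kE eF]]; last by move: jF; rewrite eF inE => /eqP ->.
have := incomparable_lines rk3 simpleM FL GL; rewrite /incomparable (proper_sub FG) /=.
by move=> h; case: eqP (h) => [e|_ /(_ isT)//]; move: FG; rewrite e properxx.
Qed.

Lemma flag_xmon F G j : val F = [set j] -> val G \in Ls -> j \in val G ->
  exists sigma : cone M (Defs.dim M), xmon sigma = xvar F * xvar G.
Proof.
move=> eF GL jG; have sz : size [:: F; G] == Defs.dim M by rewrite dim2.
have ch : is_chain (Tuple sz).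
  rewrite /is_chain /= andbT /flat_lt properE eF sub1set jG.
  apply/negP => /subset_leq_card; rewrite cards1.
  by have := line_gt1 lsE GL; lia.
by exists (exist _ (Tuple sz) ch); rewrite /xmon /flats_of /= !big_cons big_nil mulr1.
Qed.

Lemma exists_flag : exists F G j, [/\ val F = [set j], val G \in Ls & j \in val G].
Proof.
have /card_gt1P[p [q [pE qE pq]]] : (1 < #|E|)%N by have := card_ground_gt2 rk3; lia.
have [L [LL pL qL]] := line_join lsE pE qE pq.
have [F eF] := point_pflat rk3 simpleM pE; have [G eG] := line_pflat rk3 simpleM LL.
by exists F, G, p; rewrite eF eG.
Qed.

(** [deg] is chosen by [epsilon], so its properties require a witness; [chow_degree] is one. It is
    bijective in degree 2 because [e] generates that degree and has value 1. *)
Lemma exists_degree_map : exists f : {additive chow M -> int}, is_degree_map f.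
Proof.
have [F0 [G0 [i0 [eF0 G0L i0G]]]] := exists_flag.
have i0E := mem_pflat i0G.
pose mixin := GRing.isZmodMorphism.Build _ _ chow_degree chow_degree_zmod_morphism.
pose f : {additive chow M -> int} := HB.pack chow_degree mixin.
have fE p : f (chow_proj p) = degree_form p by apply: chow_degree_proj.
have f_flag F G j : val F = [set j] -> val G \in Ls -> j \in val G -> f (xvar F * xvar G) = 1.
  move=> eF GL jG; rewrite -rmorphM fE -[pvar F * _]mul1r degree_form_mul2.
  by rewrite (pairing_flag eF GL jG) mulr1 mcoeff1 eqxx.
set e := alpha i0 * xvar F0.
have eE : e = xvar F0 * xvar G0 by rewrite /e (alpha_point i0E eF0 G0L i0G) mulrC.
have fe : f e = 1 by rewrite eE; apply: f_flag eF0 G0L i0G.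
have gr2 a : chow_gr (Defs.dim M) a -> exists z, a = e *~ z.
  rewrite dim2 => -[p /dhomogP hp ->]; rewrite [p]mpolyE rmorph_sum big_seq.
  apply: (big_ind (fun x => exists z : int, x = e *~ z))
    => [|x y [zx ->] [zy ->]|m /hp /mdeg2P[i [j ->]]].
  - by exists 0; rewrite mulr0z.
  - by exists (zx + zy); rewrite mulrzDr.
  - rewrite -[p@_m]intz scaler_int rmorphMz rmorphM /=.
    have [z ez] := xvar_mul_multiple (enum_val i) (enum_val j) i0E eF0.
    move: ez; rewrite /xvar /pvar !enum_valK => ->.
    by exists (z * p@_m); rewrite mulrzA.
exists f; split.
- by move=> sigma; have [F [G [j [-> eF GL jG]]]] := xmonE sigma; apply: f_flag eF GL jG.
- by move=> a b /gr2[z ->] /gr2[z' ->]; rewrite !raddfMz fe !intz => ->.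
- move=> z; exists (e *~ z); last by rewrite raddfMz fe intz.
  rewrite dim2; exists ((pvar F0 * pvar G0) *~ z); last by rewrite rmorphMz rmorphM eE.
  have hF F : pvar F \is 1.-homog by rewrite dhomogX /= mdeg1.
  exact: (rpredMz _ (dhomogM (hF F0) (hF G0))).
- move=> k a kd [p hp ->]; rewrite fE /degree_form /subst_along.
  rewrite dim2 in kd; rewrite (eval_along_homog _ hp kd) big1 ?subr0 // => L _.
  by rewrite (eval_along_homog _ hp kd).
Qed.

Lemma degP : is_degree_map (Defs.deg M).
Proof. exact: epsilon_spec exists_degree_map. Qed.

Lemma deg_alpha_point i j F : i \in E -> val F = [set j] ->
  Defs.deg M (alpha i * xvar F) = 1.
Proof.
move=> iE eF; have [F0 [G0 [i0 [eF0 G0L i0G]]]] := exists_flag.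
rewrite (alpha_points iE eF eF0) (alpha_point iE eF0 G0L i0G) mulrC.
by have [sigma <-] := flag_xmon eF0 G0L i0G; case: degP.
Qed.

Lemma deg_point_line F G j : val G = [set j] -> val F \in Ls ->
  Defs.deg M (xvar F * xvar G) = (j \in val F)%:R.
Proof.
move=> eG FL; have [jF|jF] := boolP (j \in val F); last first.
  by rewrite mulrC (point_line_mul eG FL jF) raddf0.
by rewrite -(alpha_point (mem_pflat jF) eG FL jF) (deg_alpha_point (mem_pflat jF) eG).
Qed.

Lemma deg_line_line F G : val F \in Ls -> val G \in Ls ->
  Defs.deg M (xvar F * xvar G) = - (F == G)%:R.
Proof.
move=> FL GL; have [->|FG] := eqVneq F G; last by rewrite lines_mul // raddf0 oppr0.
have /card_gt1P[p [_ [pG _ _]]] := line_gt1 lsE GL; have pE := mem_pflat pG.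
have [H eH] := point_pflat rk3 simpleM pE.
by rewrite (line_sq pE eH GL pG) raddfN /= (deg_alpha_point pE eH).
Qed.

(** The coefficients are forced by the degrees against the variables: a line [L] must give
    [2 - #|L|], which fixes that of [xvar], and a point must give 2 minus its valency, which by
    [sum_pencil_excess] fixes that of [alpha]. *)
Definition csm_class i : chow M :=
  alpha i *~ (3 - #|E|%:Z)
  + \sum_(F : pflat M | val F \in Ls) xvar F *~ (#|val F|%:Z - 2).

Lemma sum_pencil_excess j : j \in E ->
  \sum_(L in Ls | j \in L) (#|L|%:Z - 2) = #|E|%:Z - 1 - (valency j)%:Z.
Proof.
move=> jE; have := congr1 Posz (sum_pencil_line lsE jE).
have -> : #|E|.-1 = #|E|%:Z - 1 :> int by have := card_ground_gt2 rk3; lia.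
move=> <-; rewrite -[(\sum_(L in _) _)%N%:Z]natz natr_sum -[(valency j)%:Z]natz.
rewrite -sumr_const -sumrB; apply: eq_big => [L|L /andP[LL _]]; first by rewrite [RHS]inE.
by rewrite natz; have := line_gt1 lsE LL; lia.
Qed.

Lemma deg_csm_point i j G : i \in E -> val G = [set j] ->
  Defs.deg M (csm_class i * xvar G) = 2 - (valency j)%:Z.
Proof.
move=> iE eG; have jE : j \in E by apply: (@mem_pflat _ _ G); rewrite eG inE.
rewrite mulrDl raddfD /= mulrzAl raddfMz /= (deg_alpha_point iE eG) intz.
rewrite mulr_suml raddf_sum /=.
rewrite (eq_bigr (fun F => (j \in val F)%:R * (#|val F|%:Z - 2))) => [|F FL]; last first.
  by rewrite mulrzAl raddfMz /= (deg_point_line eG FL) -mulrzr intz.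
rewrite (sum_pflat_all_lines rk3 simpleM (fun L => (j \in L)%:R * (#|L|%:Z - 2))).
have -> : \sum_(L in Ls) (j \in L)%:R * (#|L|%:Z - 2) = \sum_(L in Ls | j \in L) (#|L|%:Z - 2).
  by rewrite [RHS]big_mkcondr; apply: eq_bigr => L _; case: ifP; rewrite ?mul1r ?mul0r.
by rewrite sum_pencil_excess //; ring.
Qed.

Lemma deg_csm_line i G : i \in E -> val G \in Ls ->
  Defs.deg M (csm_class i * xvar G) = 2 - #|val G|%:Z.
Proof.
move=> iE GL; rewrite mulrDl raddfD /= mulrzAl (alpha_line iE GL) mul0rz raddf0 add0r.
rewrite mulr_suml raddf_sum (bigD1 G) //= big1 ?addr0 => [|F /andP[FL FG]].
  by rewrite mulrzAl raddfMz /= deg_line_line // eqxx mulNrz intz opprB.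
by rewrite mulrzAl raddfMz /= deg_line_line // (negPf FG) oppr0 mul0rz.
Qed.

Lemma deg_csm_sq i : i \in E -> Defs.deg M (csm_class i * csm_class i)
  = (#|E|%:Z - 3) ^+ 2 - \sum_(L in Ls) (#|L|%:Z - 2) ^+ 2.
Proof.
move=> iE; rewrite [X in _ * X]/csm_class mulrDr raddfD /= mulrzAr raddfMz /=.
(* With [alpha] expanded at [i], the valency of [i] cancels. *)
have -> : Defs.deg M (csm_class i * alpha i) = 3 - #|E|%:Z.
  have [G eG] := point_pflat rk3 simpleM iE.
  rewrite /alpha (sum_pflat_mem rk3 simpleM _ eG) mulrDr raddfD /= (deg_csm_point iE eG).
  rewrite mulr_sumr raddf_sum /=.
  rewrite (eq_bigr (fun F => - (#|val F|%:Z - 2))) => [|F /andP[FL _]]; last first.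
    by rewrite deg_csm_line // opprB.
  rewrite (sum_pflat_lines rk3 simpleM (fun L => - (#|L|%:Z - 2)) (fun L => i \in L)).
  by rewrite sumrN sum_pencil_excess //; ring.
rewrite mulr_sumr raddf_sum /=.
rewrite (eq_bigr (fun F => - (#|val F|%:Z - 2) ^+ 2)) => [|F FL]; last first.
  by rewrite mulrzAr raddfMz /= deg_csm_line // -mulrzr intz; ring.
rewrite (sum_pflat_all_lines rk3 simpleM (fun L => - (#|L|%:Z - 2) ^+ 2)).
by rewrite sumrN -[_ *~ _]mulrzr intz; ring.
Qed.

Lemma csm_class_gr i : chow_gr 1 (csm_class i).
Proof.
exists ((\sum_(F : pflat M | i \in val F) pvar F) *~ (3 - #|E|%:Z)
  + \sum_(F : pflat M | val F \in Ls) pvar F *~ (#|val F|%:Z - 2)).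
  have h F : pvar F \is 1.-homog by rewrite dhomogX /= mdeg1.
  by rewrite rpredD ?rpredMz ?rpred_sum // => F _; rewrite rpredMz.
rewrite rmorphD rmorphMz !rmorph_sum /csm_class; congr (_ + _).
by apply: eq_bigr => F _; rewrite rmorphMz.
Qed.

Lemma flats_of1 (sigma : cone M 1) : exists F, flats_of sigma = [:: F].
Proof.
have : size (flats_of sigma) = 1%N by rewrite size_tuple.
by case: (flats_of sigma) => [|F []] // _; exists F.
Qed.

Lemma ray F : exists sigma : cone M 1, flats_of sigma = [:: F].
Proof. by exists (exist _ [tuple F] isT). Qed.

Lemma deg_weight_csm i : i \in E -> deg_weight 1 (csm_class i) = csm_weight M 1.
Proof.
move=> iE; apply/ffunP => sigma; have [F eF] := flats_of1 sigma; rewrite !ffunE /xmon eF.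
(* The weight of the ray of [F] becomes [- beta (M|F) * beta (M/F)]. *)
rewrite big_seq1 dim2 subn1 expr1 mulN1r !big_ord_recl big_ord0 mulr1 /=.
case: (pflatP rk3 simpleM F) => [FL|[j jE ej]].
  rewrite deg_csm_line // (beta_restrict_line rk3 simpleM FL).
  by rewrite (beta_contract_line rk3 simpleM FL) mulr1 opprB.
rewrite (deg_csm_point iE ej) ej (beta_restrict_point simpleM jE).
by rewrite (beta_contract_point rk3 simpleM jE) mul1r opprB.
Qed.

(** [csm] falls back to 0 on unbalanced weights; balancing holds here because the weight comes from
    a Chow class. *)
Lemma csm1E i : i \in E -> chow_to_MW 1 (csm_class i) = csm M 1.
Proof.
move=> iE; apply: val_inj; rewrite /csm /insubd -(deg_weight_csm iE).
by rewrite insubT ?deg_weight_balanced.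
Qed.

(** A class of degree 1 is an integer combination of variables. This lets the class picked by
    [MW_to_chow] be replaced by [csm_class], which has the same weight. *)
Lemma chow_gr1_mul (a b c : chow M) : chow_gr 1 a ->
  (forall F, Defs.deg M (b * xvar F) = Defs.deg M (c * xvar F)) ->
  Defs.deg M (a * b) = Defs.deg M (a * c).
Proof.
move=> [p /dhomogP hp ->] bc; rewrite [p]mpolyE rmorph_sum !mulr_suml !raddf_sum /=.
rewrite big_seq [RHS]big_seq; apply: eq_bigr => m /hp /eqP /mdeg1P[i /eqP ->].
rewrite -[p@_ _]intz scaler_int rmorphMz !mulrzAl !raddfMz /=; congr (_ *~ _).
by have := bc (enum_val i); rewrite /xvar /pvar enum_valK ![_ * chow_proj _]mulrC.
Qed.

Lemma c1_sqE : c1_sq rk3 = (#|E|%:Z - 3) ^+ 2 - \sum_(L in Ls) (#|L|%:Z - 2) ^+ 2.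
Proof.
have /set0Pn[i iE] := ground_neq0 rk3.
rewrite -(deg_csm_sq iE) /c1_sq /vertex_weight /MW_mul /= ffunE /xmon /= big_nil mulr1.
set a := MW_to_chow _.
have [ga ea] : chow_gr (Defs.dim M - 1) a /\ chow_to_MW 1 a = csm M 1.
  apply: (epsilon_spec (inhabits 0)
    (fun a => chow_gr (Defs.dim M - 1) a /\ chow_to_MW 1 a = csm M 1)).
  by exists (csm_class i); rewrite dim2 csm1E //; split => //; apply: csm_class_gr.
rewrite dim2 in ga.
have eq F : Defs.deg M (a * xvar F) = Defs.deg M (csm_class i * xvar F).
  have [sigma es] := ray F.
  have := congr1 (fun w : MW M 1 => val w sigma) ea.
  by rewrite -(csm1E iE) /= !ffunE /xmon es big_seq1.
(* The replacement is made in one factor at a time. *)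
by rewrite (chow_gr1_mul ga eq) mulrC (chow_gr1_mul (csm_class_gr i) eq).
Qed.

Lemma c2E : c2 M = 3 - 2 * #|E|%:Z + \sum_(L in Ls) (#|L|%:Z - 1).
Proof.
(* Balancing is vacuous on the vertex. *)
have b0 : csm_weight M 0 \in @balanced T M 0 by [].
rewrite /c2 /vertex_weight /csm insubdK // ffunE dim2 /= big_ord_recl big_ord0 mulr1 /=.
by rewrite beta_restrict_ground (beta_rank3 rk3 simpleM) expr2 mulrNN !mul1r.
Qed.

End ChowDegree.

(** * Chern numbers *)

Section ChernRatio.
Variables (T : finType) (M : matroid T).
Hypotheses (rk3 : rank M = 3%N) (simpleM : simple_matroid M).
Hypothesis no_coloop : forall i, ~~ coloop M i.
Local Notation E := (ground M).
Local Notation Ls := (rank2_flats M).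

Let lsE := rank3_linear_space rk3 simpleM.

Lemma rk_no_coloop i : i \in E -> rk M (E :\ i) = 3%N.
Proof.
move=> iE; have := no_coloop i; rewrite /coloop iE /= rk3.
have sE : E :\ i \subset E by apply: subsetDl.
have siE : [set i] \subset E by rewrite sub1set.
have := rk_submod sE siE; rewrite [E :\ i :|: _]setUC setD1K // -/(rank M) rk3.
have := rk_card siE; rewrite cards1; have := rk_le3 rk3 sE.
by move: (rk M (E :\ i)) (rk M [set i]) => a b; rewrite eqSS; lia.
Qed.

Lemma card_ground_gt3 : (3 < #|E|)%N.
Proof.
have /set0Pn[i iE] := ground_neq0 rk3.
have := @rk_card _ M _ (subsetDl E [set i]); rewrite rk_no_coloop // (cardsD1 i E) iE.
by rewrite add1n.
Qed.

(** If [x] were the only point off [L], then [E :\ x] would be [L], of rank 2, and [x] a coloop. *)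
Lemma card_line_coloop L : L \in Ls -> (#|L|.+1 < #|E|)%N.
Proof.
move=> LL; have [LE _ L2] := rank2_flatP LL.
have [x xE xL] := exists_off_line lsE LL.
have LD : L \subset E :\ x by rewrite subsetD1 LE.
rewrite (cardsD1 x E) xE add1n ltnS proper_card // properEneq LD andbT.
by apply/eqP => e; have := rk_no_coloop xE; rewrite -e L2.
Qed.

(** * Two linear combinations of the Chern numbers *)

Lemma sum_line_pairs_int :
  \sum_(L in Ls) (#|L|%:Z ^+ 2 - #|L|%:Z) = #|E|%:Z ^+ 2 - #|E|%:Z.
Proof.
have sq k : k%:Z ^+ 2 - k%:Z = (k * k.-1)%N%:Z by case: k => // k; rewrite /= PoszM; lia.
rewrite sq -(sum_line_pairs lsE) -[RHS]natz natr_sum.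
by apply: eq_bigr => L _; rewrite sq natz.
Qed.

Lemma chern_diff : 3 * c2 M - c1_sq rk3 = #|Ls|%:Z - #|E|%:Z.
Proof.
rewrite (c1_sqE rk3 simpleM) (c2E rk3 simpleM).
(* Termwise, [(k - 2)^2 + 3 (k - 1) = k^2 - k + 1]. *)
have e1 : \sum_(L in Ls) (#|L|%:Z - 2) ^+ 2 + 3 * \sum_(L in Ls) (#|L|%:Z - 1)
    = \sum_(L in Ls) (#|L|%:Z ^+ 2 - #|L|%:Z) + #|Ls|%:Z.
  rewrite mulr_sumr -big_split -[#|Ls|%:Z]natz -sumr_const -big_split /=.
  by apply: eq_bigr => L _; ring.
by rewrite sum_line_pairs_int in e1; lia.
Qed.

Definition chern_excess : int :=
  \sum_(L in Ls) (#|L|%:Z - 2) * (#|E|%:Z - #|L|%:Z - 1).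

Lemma chern_excessE :
  (#|E|%:Z - 2) * c1_sq rk3 - 2 * (#|E|%:Z - 3) * c2 M = chern_excess.
Proof.
rewrite (c1_sqE rk3 simpleM) (c2E rk3 simpleM) /chern_excess.
set n := #|E|%:Z.
(* The first two coefficients are those of the line sums in the left-hand combination; the rest is a
   multiple of [k^2 - k], known from the count of pairs. *)
have -> : \sum_(L in Ls) (#|L|%:Z - 2) * (n - #|L|%:Z - 1)
   = - (n - 2) * \sum_(L in Ls) (#|L|%:Z - 2) ^+ 2
     - 2 * (n - 3) * \sum_(L in Ls) (#|L|%:Z - 1)
     + (n - 3) * \sum_(L in Ls) (#|L|%:Z ^+ 2 - #|L|%:Z).
  rewrite !mulr_sumr -sumrB -big_split /=.
  by apply: eq_bigr => L _; ring.
by rewrite sum_line_pairs_int -/n; ring.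
Qed.

Lemma chern_excess_term_ge0 L : L \in Ls ->
  0 <= (#|L|%:Z - 2) * (#|E|%:Z - #|L|%:Z - 1).
Proof.
by move=> LL; have := line_gt1 lsE LL; have := card_line_coloop LL => *; apply: mulr_ge0; lia.
Qed.

Lemma chern_excess_ge0 : 0 <= chern_excess.
Proof. exact: sumr_ge0 chern_excess_term_ge0. Qed.

Lemma chern_excess_eq0 : chern_excess = 0 <-> (forall L, L \in Ls -> #|L| = 2%N).
Proof.
split=> [/eqP|L2]; last by rewrite /chern_excess big1 // => L /L2 ->; rewrite subrr mul0r.
rewrite psumr_eq0; last exact: chern_excess_term_ge0.
move=> /allP z L LL; have := z L (mem_index_enum _); rewrite LL mulf_eq0 /=.
by have := card_line_coloop LL; lia.
Qed.

(** Eliminating [c1_sq] from [chern_diff] and [chern_excessE] gives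
    [n c_2 = chern_excess + (n - 2) (b - n)], with both summands nonnegative. If both vanished, all
    lines would have two points and [b = n], so [n (n - 1) = 2 n], against [n > 3]. *)
Lemma c2_gt0 : 0 < c2 M.
Proof.
have n3 := card_ground_gt3; have ge := chern_excess_ge0.
have := chern_excessE; have := chern_diff => d x.
have db : #|E|%:Z <= #|Ls|%:Z by rewrite lez_nat (de_bruijn_erdos lsE) // ltnW // ltnW.
have e : #|E|%:Z * c2 M = chern_excess + (#|E|%:Z - 2) * (#|Ls|%:Z - #|E|%:Z).
  by rewrite -x -d; ring.
have h : 0 <= (#|E|%:Z - 2) * (#|Ls|%:Z - #|E|%:Z) by apply: mulr_ge0; lia.
have n0 : 0 < #|E|%:Z by lia.
rewrite -(pmulr_rgt0 _ n0) e lt_def addr_ge0 // andbT paddr_eq0 //.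
apply/negP => /andP[/eqP /chern_excess_eq0 L2]; rewrite mulf_eq0 => bn.
have : \sum_(L in Ls) (#|L|%:Z ^+ 2 - #|L|%:Z) = 2 * #|Ls|%:Z.
  rewrite (eq_bigr (fun=> 2)) => [|L /L2 -> //].
  by rewrite sumr_const -[LHS]mulr_natr [X in _ * X = _]natz.
rewrite sum_line_pairs_int; have -> : #|Ls|%:Z = #|E|%:Z by lia.
by nia.
Qed.

(** * The equality cases *)

Lemma uniform_lines : is_uniform M 3 <-> (forall L, L \in Ls -> #|L| = 2%N).
Proof.
split=> [u L LL|L2 S SE].
  by have [LE _] := rank2_flatP LL; rewrite (u _ LE); lia.
have [S1|S1] := ltnP 1 #|S|; last first.
  have [->|S0] := eqVneq S set0; first by rewrite rk_set0 cards0.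
  have /cards1P[i Si] : #|S| == 1%N by move: S1 S0; rewrite -cards_eq0; lia.
  by rewrite Si cards1 simple_rk1 // -sub1set -Si.
have le := rk_card SE; have le3 := rk_le3 rk3 SE; have ge2 := rk_ge2 simpleM SE S1.
have [S2|nS2] := eqVneq (rk M S) 2%N; last by lia.
have [L LL /subset_leq_card] := rk2_line SE S2.
by rewrite (L2 _ LL); lia.
Qed.

(** If some line has two points, a point off it lies on exactly two lines. These cover [E] and share
    that point, so their sizes add up to at least [n + 1]; each being at most [n - 2], both are at
    least 3. Otherwise every line is long. *)
Lemma exists_two_long_lines :
  (forall p L, p \in E -> L \in Ls -> p \notin L -> #|pencil Ls p| = #|L|) ->
  exists L1 L2, [/\ L1 \in Ls, L2 \in Ls, L1 != L2, (2 < #|L1|)%N & (2 < #|L2|)%N].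
Proof.
move=> eqd.
have [/exists_inP[L LL /eqP L2]|] := boolP [exists L in Ls, #|L| == 2%N].
  have [p pE pL] := exists_off_line lsE LL.
  have /eqP/cards2P[L1 [L2' [nL e]]] := etrans (eqd p L pE LL pL) L2.
  have : L1 \in pencil Ls p /\ L2' \in pencil Ls p by rewrite e !inE !eqxx orbT.
  rewrite ![_ \in pencil _ _]inE => -[/andP[L1L pL1] /andP[L2L pL2]].
  have sE : E \subset L1 :|: L2'.
    apply/subsetP => q qE; have [<-|pq] := eqVneq p q; first by rewrite inE pL1.
    have [K [KL pK qK]] := line_join lsE pE qE pq.
    have : K \in pencil Ls p by rewrite inE KL.
    by rewrite e !inE => /orP[] /eqP <-; rewrite qK ?orbT.
  have := subset_leq_card sE; rewrite cardsU.
  have : (0 < #|L1 :&: L2'|)%N by apply/card_gt0P; exists p; rewrite inE pL1.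
  have := card_line_coloop L1L; have := card_line_coloop L2L => *.
  by exists L1, L2'; split => //; lia.
rewrite negb_exists_in => /forall_inP nL2.
have long L : L \in Ls -> (2 < #|L|)%N.
  by move=> LL; rewrite ltn_neqAle eq_sym nL2 // (line_gt1 lsE).
have n3 := card_ground_gt3.
have /card_gt1P[p [q [pE qE pq]]] : (1 < #|E|)%N by lia.
have [L1 [L1L pL1 qL1]] := line_join lsE pE qE pq.
have [r rE rL1] := exists_off_line lsE L1L.
have [|L2 [L2L pL2 rL2]] := line_join lsE pE rE; first by apply: contraNneq rL1 => <-.
by exists L1, L2; split; rewrite ?long //; apply: contraNneq rL1 => ->.
Qed.

(** Take two points on each line away from the other. Any three of the four include two from one
    line and one from the other. *)
Lemma quadrangle L1 L2 : L1 \in Ls -> L2 \in Ls -> L1 != L2 ->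
  (2 < #|L1|)%N -> (2 < #|L2|)%N ->
  exists Q : {set T}, [/\ Q \subset E, #|Q| = 4%N & forall A : {set T},
    A \subset Q -> #|A| = 3%N -> ~ exists2 L : {set T}, L \in Ls & A \subset L].
Proof.
have two (K1 K2 : {set T}) : K1 \in Ls -> K2 \in Ls -> K1 != K2 -> (2 < #|K1|)%N ->
    exists2 Q : {set T}, Q \subset K1 :\: K2 & #|Q| = 2%N.
  move=> K1L K2L K12 K1gt; have le := card_line_meet lsE K1L K2L K12.
  have /card_gt1P[a [b [aD bD ab]]] : (1 < #|K1 :\: K2|)%N by rewrite cardsD; lia.
  by exists [set a; b]; rewrite ?cards2 ?ab // subUset !sub1set aD.
(* A line [L] through two points of [K1] is [K1], so it misses the points of [Q2]. *)
have bad (K1 K2 Q1 Q2 A L : {set T}) : K1 \in Ls -> K2 \in Ls -> L \in Ls ->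
    Q1 \subset K1 :\: K2 -> Q2 \subset K2 :\: K1 -> A \subset L ->
    (1 < #|A :&: Q1|)%N -> (0 < #|A :&: Q2|)%N -> False.
  move=> K1L K2L LL sQ1 sQ2 AL /card_gt1P[p [q [pAQ qAQ pq]]] /card_gt0P[r].
  move: pAQ qAQ; rewrite !inE => /andP[pA /(subsetP sQ1)] pK /andP[qA /(subsetP sQ1)] qK.
  move=> /andP[rA /(subsetP sQ2)]; move: pK qK; rewrite !inE.
  move=> /andP[_ pK] /andP[_ qK] /andP[/negP rK1 _]; apply: rK1.
  have -> : K1 = L by apply: (line_inj lsE K1L LL pq) => //; apply: (subsetP AL).
  exact: (subsetP AL).
move=> L1L L2L L12 L1gt L2gt.
have [Q1 sQ1 cQ1] := two _ _ L1L L2L L12 L1gt.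
have [Q2 sQ2 cQ2] := two _ _ L2L L1L (etrans (congr1 negb (eq_sym _ _)) L12) L2gt.
have Q1L := subset_trans sQ1 (subsetDl _ _); have Q2L := subset_trans sQ2 (subsetDl _ _).
have dQ : Q1 :&: Q2 = set0.
  apply/setP => x; rewrite !inE; apply/negP => /andP[/(subsetP sQ1)].
  by rewrite inE => /andP[xL2 _] /(subsetP Q2L) xL2'; rewrite xL2' in xL2.
exists (Q1 :|: Q2); split.
- rewrite subUset (subset_trans Q1L (line_sub lsE L1L)).
  by rewrite (subset_trans Q2L (line_sub lsE L2L)).
- by rewrite cardsU dQ cards0 cQ1 cQ2.
- move=> A AQ A3 [L LL AL].
  have : #|A| = (#|A :&: Q1| + #|A :&: Q2|)%N.
    by rewrite -{1}(setIidPl AQ) setIUr cardsU setIACA dQ setI0 cards0 subn0.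
  have := subset_leq_card (subsetIr A Q1); have := subset_leq_card (subsetIr A Q2).
  rewrite cQ1 cQ2 A3 => le2 le1 e.
  have [c1|c1] := ltnP 1 #|A :&: Q1|.
    by apply: (bad _ _ _ _ _ _ L1L L2L LL sQ1 sQ2 AL c1); lia.
  by apply: (bad _ _ _ _ _ _ L2L L1L LL sQ2 sQ1 AL); lia.
Qed.

(** Both directions pass through the equality of [#|pencil Ls p|] and [#|L|] for nonincident pairs:
    it follows from the lines meeting pairwise, and conversely from equality in de Bruijn-Erdos. *)
Lemma projective_plane_card_lines :
  is_projective_plane_matroid M <-> #|Ls| = #|E|.
Proof.
have n3 := card_ground_gt3; have E1 : (1 < #|E|)%N by lia.
split=> [[lines [sub join meet _] [_ _ fl]]|bn].
  have eL : lines = Ls by apply/setP => F; rewrite -fl [RHS]inE.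
  rewrite eL in meet; apply: (card_lines_eq lsE E1) => p L pE LL pL.
  apply: (card_pencil_eq lsE pE LL pL) => L' L'L nL.
  by have [x [xL _]] := meet _ _ LL L'L nL; apply/set0Pn; exists x.
have [|_ eqd] := de_bruijn_erdos_eq lsE E1; first by rewrite bn.
exists Ls; last by split => // F; rewrite [RHS]inE.
split.
- by move=> L /(line_sub lsE).
- move=> p q pE qE pq; have [L [LL pL qL]] := line_join lsE pE qE pq.
  exists L; split => // L' [L'L pL' qL'].
  exact: (line_inj lsE LL L'L pq).
- move=> L L' LL L'L nL.
  have /eqP/cards1P[x ex] := line_meet lsE LL L'L nL (fun p pE => eqd p L pE LL).
  by exists x; rewrite ex; split => [|y]; rewrite ?inE // => /eqP.
- have [L1 [L2 [L1L L2L L12 gt1 gt2]]] := exists_two_long_lines eqd.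
  exact: quadrangle L1L L2L L12 gt1 gt2.
Qed.

End ChernRatio.

Theorem theorem1p5 (T : finType) (M : matroid T) (n : nat)
    (rk3 : rank M = 3%N) (card_E : #|ground M| = n)
    (simpleM : simple_matroid M) (no_coloop : forall i : T, ~~ coloop M i) :
  let ratio : rat := (c1_sq rk3)%:~R / (c2 M)%:~R in
  let bound : rat := (2 * n%:R - 6) / (n%:R - 2) in
  [/\ bound <= ratio <= 3,
      ratio = bound <-> is_uniform M 3
    & ratio = 3 <-> is_projective_plane_matroid M].
Proof.
move=> ratio bound.
have n3 := card_ground_gt3 rk3 no_coloop; rewrite card_E in n3.
have c0 := c2_gt0 rk3 simpleM no_coloop.
have c0Q : 0 < (c2 M)%:~R :> rat by rewrite ltr0z.
have n0Q : 0 < n%:R - 2 :> rat by rewrite subr_gt0 ltr_nat; lia.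
have exc := chern_excessE rk3 simpleM; rewrite card_E in exc.
have excQ : (n%:R - 2) * (c1_sq rk3)%:~R - (2 * n%:R - 6) * (c2 M)%:~R
    = (chern_excess M)%:~R :> rat.
  by rewrite -exc rmorphB !rmorphM !rmorphB /= -!pmulrn; ring.
have dif := chern_diff rk3 simpleM; rewrite card_E in dif.
have difQ : 3 * (c2 M)%:~R - (c1_sq rk3)%:~R
    = #|rank2_flats M|%:R - n%:R :> rat.
  by have := congr1 (fun z : int => z%:~R : rat) dif; rewrite !rmorphB rmorphM /= -!pmulrn.
(* Both denominators are positive, so the bounds and the equality cases depend only on the
   numerators of these two differences. *)
have ratioE : ratio - bound = (chern_excess M)%:~R / ((n%:R - 2) * (c2 M)%:~R).
  by rewrite -excQ /ratio /bound; field; rewrite !gt_eqF.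
have ratio3 : 3 - ratio = (#|rank2_flats M|%:R - n%:R) / (c2 M)%:~R.
  by rewrite -difQ /ratio; field; rewrite gt_eqF.
have lsE := rank3_linear_space rk3 simpleM.
split.
- apply/andP; split.
    rewrite -subr_ge0 ratioE divr_ge0 ?ler0z ?(chern_excess_ge0 rk3 simpleM no_coloop) //.
    by rewrite mulr_ge0 // ltW.
  rewrite -subr_ge0 ratio3 divr_ge0 ?(ltW c0Q) // subr_ge0 ler_nat -card_E.
  by apply: (de_bruijn_erdos lsE); rewrite card_E; lia.
- rewrite (uniform_lines rk3 simpleM) -(chern_excess_eq0 rk3 simpleM no_coloop).
  have -> : (ratio = bound) <-> (ratio - bound = 0).
    by split => [->|/eqP]; [rewrite subrr | rewrite subr_eq0 => /eqP].
  rewrite ratioE; split => [/eqP|->]; last by rewrite mul0r.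
  by rewrite mulf_eq0 invr_eq0 mulf_eq0 (gt_eqF n0Q) (gt_eqF c0Q) !orbF intr_eq0 => /eqP.
- rewrite (projective_plane_card_lines rk3 simpleM no_coloop) card_E.
  have -> : (ratio = 3) <-> (3 - ratio = 0).
    by split => [->|/eqP]; [rewrite subrr | rewrite subr_eq0 => /eqP ->].
  rewrite ratio3; split => [/eqP|->]; last by rewrite subrr mul0r.
  by rewrite mulf_eq0 invr_eq0 (gt_eqF c0Q) orbF subr_eq0 eqr_nat => /eqP.
Qed.
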